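(* Let $G$ be a connected 3-regular graph in which every vertex lies in at least one 3-cycle. Then $G$ has a color-blind distinguishing edge-coloring (with some finite number of colors) if and only if $G$ is not an odd cycle of diamonds. Moreover, when $G$ is not an odd cycle of diamonds, $\operatorname{dal}(G)\le 3$.
   Context: For an edge-coloring $c:E(G)\to\{1,\dots,k\}$ (not necessarily proper), let $\bar c(v)=(a_1,\dots,a_k)$ where $a_i$ is the number of edges at $v$ of color $i$, and let $c^*(v)$ be $\bar c(v)$ sorted in nonincreasing order. The coloring is color-blind distinguishing if $c^*(u)\ne c^*(v)$ for every edge $uv$. $\operatorname{dal}(G)$ is the least $k$ for which such a coloring with colors $\{1,\dots,k\}$ exists ($\infty$ if none exists). A diamond is a subgraph consisting of two 3-cycles sharing an edge, i.e. vertices $x,y,z,w$ with edges $xy,xz,yz,yw,zw$. A cycle of diamonds is a 3-regular graph in which every vertex lies in a diamond; it is an odd cycle of diamonds if it has $4t$ vertices for an odd integer $t$. (In particular $K_4$ is an odd cycle of diamonds.) *)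

(* Defs.v *)
From HB Require Import structures.
From mathcomp Require Import all_boot.
From mathcomp Require Import boolp.
Set Implicit Arguments.
Unset Strict Implicit.
Unset Printing Implicit Defensive.

Record sgraph := SGraph {
  vertex :> finType;
  adj : rel vertex;
  adj_sym : symmetric adj;
  adj_irrefl : irreflexive adj
}.

Notation "x -- y" := (adj x y) (at level 30).

Definition connected_graph (G : sgraph) : Prop :=
  0 < #|G| /\ forall x y : G, connect (@adj G) x y.

Definition regular_graph (G : sgraph) (d : nat) : Prop :=
  forall v : G, #|[set u : G | v -- u]| = d.

(* The three vertices are distinct because adjacency is irreflexive. *)
Definition in_triangle (G : sgraph) (v : G) : Prop :=
  exists x y : G, [&& v -- x, x -- y & y -- v].

(* The subgraph need not be induced: x and w may be adjacent, as in K4.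
   The remaining distinctness conditions follow from irreflexivity. *)
Definition diamond (G : sgraph) (x y z w : G) : bool :=
  [&& x != w, x -- y, x -- z, y -- z, y -- w & z -- w].

Definition in_diamond (G : sgraph) (v : G) : Prop :=
  exists x y z w : G, diamond x y z w /\ v \in [:: x; y; z; w].

Definition cycle_of_diamonds (G : sgraph) : Prop :=
  regular_graph G 3 /\ forall v : G, in_diamond v.

Definition odd_cycle_of_diamonds (G : sgraph) : Prop :=
  cycle_of_diamonds G /\ exists t : nat, odd t /\ #|G| = 4 * t.

Definition edges (G : sgraph) : {set {set G}} :=
  [set A : {set G} | [exists x : G, exists y : G,
     (x -- y) && (A == [set x; y])]].

Definition edge (G : sgraph) := {A : {set G} | A \in edges G}.

Definition edge_coloring (G : sgraph) (k : nat) := {ffun edge G -> 'I_k}.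

Definition color_count (G : sgraph) (k : nat) (c : edge_coloring G k)
    (v : G) (i : 'I_k) : nat :=
  #|[set A : edge G | (v \in val A) && (c A == i)]|.

Definition cbar (G : sgraph) (k : nat) (c : edge_coloring G k)
    (v : G) : seq nat :=
  [seq color_count c v i | i <- enum 'I_k].

Definition cstar (G : sgraph) (k : nat) (c : edge_coloring G k)
    (v : G) : seq nat :=
  sort geq (cbar c v).

Definition color_blind_distinguishing (G : sgraph) (k : nat)
    (c : edge_coloring G k) : bool :=
  [forall u : G, forall v : G, (u -- v) ==> (cstar c u != cstar c v)].

Definition color_blind_colorable (G : sgraph) (k : nat) : bool :=
  [exists c : edge_coloring G k, color_blind_distinguishing c].

(* None stands for infinity. *)
Definition dal (G : sgraph) : option nat :=
  match pselect (exists k : nat, color_blind_colorable G k) with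
  | left h => Some (ex_minn h)
  | right _ => None
  end.

(* Main.v *)
Require Import Defs.
From HB Require Import structures.
From mathcomp Require Import all_boot.
From mathcomp Require Import boolp.
Set Implicit Arguments.
Unset Strict Implicit.
Unset Printing Implicit Defensive.

(** In a cubic graph the sorted vector of a vertex is determined by the number
    (1, 2 or 3) of colours it sees, so these numbers ("types") form a proper
    vertex 3-colouring.  In a diamond the two ends have the same type, and it
    is not 1, since otherwise the two middle vertices would see the same
    colours.  If all vertices lie in diamonds, the types 2 and 3 alternate
    along the external edges, so the number of diamonds is even.

    Conversely, a proper 3-colouring by types in which no end of a diamond has
    type 1 is always realised by an edge-colouring.  Such a typing is built
    greedily, each isolated triangle vertex and each diamond being treated
    while one of its neighbours is still untyped; the slack for the last step
    comes from a cycle through an isolated triangle, and for a graph made only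
    of diamonds from the parity of their number. *)

(** The sorted vector is a partition of 3 padded with zeros, and 3, 2+1, 1+1+1 have different
    numbers of parts. Realising given types with three colours is a problem about external edges
    alone. An isolated triangle has one vertex of each type and can be coloured exactly when the
    external colour of its type 3 vertex differs from the two others; a diamond with ends of type 3
    needs equal external colours, one with ends of type 2 imposes nothing. The obstacle is that the
    external edge of a type 3 vertex may end in another triangle, which has its own constraint. Let
    each type 3 vertex point to the type 3 vertex of the triangle across its external edge: this is
    a function, so these edges can be coloured by 3-colouring its graph. Every other external edge,
    or pair of edges joined through a diamond, meets at most two triangles, and one colour is left
    for it. [K4] is set apart, since there the ends of a diamond are adjacent and the notions of
    end, middle vertex and external edge break down. *)

Definition nb (G : sgraph) (v : G) : {set G} := [set u | v -- u].

Definition seen (G : sgraph) (K : eqType) (f : G -> G -> K) (v : G) : seq K :=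
  [seq f v u | u <- enum (nb v)].

Definition ncol (G : sgraph) (K : eqType) (f : G -> G -> K) (v : G) : nat :=
  size (undup (seen f v)).

Lemma ncol3 (G : sgraph) (K : eqType) (f : G -> G -> K) (v a b c : G) :
  (forall u, v -- u = (u \in [:: a; b; c])) ->
  ncol f v = size (undup [:: f v a; f v b; f v c]).
Proof.
move=> nbv; apply/perm_size/perm_undup => i.
have nbE u : (u \in enum (nb v)) = (u \in [:: a; b; c]).
  by rewrite mem_enum inE nbv.
apply/mapP/idP => [[u]|].
  rewrite nbE !inE => /or3P[] /eqP-> ->; by rewrite eqxx ?orbT.
rewrite !inE => /or3P[] /eqP->; [exists a|exists b|exists c] => //;
  by rewrite nbE !inE eqxx ?orbT.
Qed.

Lemma eq_ncol (G : sgraph) (K L : eqType) (f : G -> G -> K) (g : G -> G -> L)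
    (h : K -> L) (v : G) :
  injective h -> (forall u, v -- u -> g v u = h (f v u)) ->
  ncol g v = ncol f v.
Proof.
move=> hI gE; rewrite /ncol.
have -> : seen g v = [seq h i | i <- seen f v].
  by rewrite -map_comp; apply/eq_in_map => u; rewrite mem_enum inE => /gE.
by rewrite undup_map_inj // size_map.
Qed.

(** Separates the positive entries, indexed by the colours that occur, from the zeros, whose number
    reveals how many colours occur. *)
Lemma count_enum_perm (k : nat) (s : seq (option 'I_k)) :
  None \notin s ->
  perm_eq [seq count_mem (Some i) s | i <- enum 'I_k]
    ([seq count_mem j s | j <- undup s] ++ nseq (k - size (undup s)) 0)
  /\ size (undup s) <= k.
Proof.
move=> sN; pose e := [seq Some i | i <- enum 'I_k].
have eU : uniq e by rewrite map_inj_uniq ?enum_uniq // => i j [].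
have es : perm_eq (undup s) (filter (mem s) e).
  apply: uniq_perm; rewrite ?undup_uniq ?filter_uniq // => j.
  rewrite mem_undup mem_filter /=; case: j => [j|]; last by rewrite (negPf sN).
  by rewrite map_f ?mem_enum ?andbT.
have ee : perm_eq e (undup s ++ filter (predC (mem s)) e).
  by rewrite perm_sym -(permPr (permEl (perm_filterC (mem s) e))) perm_cat2r.
have ke : k = size (undup s) + size (filter (predC (mem s)) e).
  by rewrite -size_cat -(perm_size ee) size_map size_enum_ord.
have sk : size (undup s) <= k by move: ke; move: (size _) => m ->; exact: leq_addr.
split=> //; have -> : k - size (undup s) = size (filter (predC (mem s)) e).
  by rewrite -(addKn (size (undup s)) (size (filter _ _))) -ke.
have -> : [seq count_mem (Some i) s | i <- enum 'I_k]
   = [seq count_mem j s | j <- e].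
  exact: (map_comp (fun j => count_mem j s) Some).
apply: perm_trans (perm_map _ ee) _; rewrite map_cat perm_cat2l.
elim: e {eU es ee ke} => //= j e IH; case: ifP => //= /negP/negP js.
by rewrite (count_memPn js) perm_cons.
Qed.

(** A partition of 3 is determined by its number of parts; the default of [nth] serves the case of
    three parts. *)
Lemma count_undup3 (K : eqType) (s : seq K) : size s = 3 ->
  perm_eq [seq count_mem j s | j <- undup s]
    (nth [:: 1; 1; 1] [:: [::]; [:: 3]; [:: 2; 1]] (size (undup s))).
Proof.
case: s => [|a [|b [|c [|]]]] // _.
have neqE (x y : K) : x != y -> ((x == y) = false) * ((y == x) = false).
  by move=> xy; rewrite [y == x]eq_sym (negPf xy).
case: (eqVneq a b) => [->|/neqE ab].
  case: (eqVneq b c) => [->|/neqE bc]; first by rewrite /= !inE !eqxx /= !eqxx.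
  by rewrite /= !inE !eqxx /= !bc /= !eqxx !bc.
case: (eqVneq a c) => [<-|/neqE ac].
  by rewrite /= !inE !eqxx !ab /= !ab !eqxx.
case: (eqVneq b c) => [<-|/neqE bc].
  by rewrite /= !inE !eqxx !ab /= !ab !eqxx.
by rewrite /= !inE !ab !ac !bc /= !eqxx !ab !ac !bc.
Qed.

(** * Vectors and numbers of colours *)

Section ColorCounts.
Variables (G : sgraph) (k : nat) (c : edge_coloring G k).
Hypothesis Greg : regular_graph G 3.

(** Totalised over pairs of vertices so that [ncol] applies to it; on edges the value is never
    [None]. *)
Definition ecol (v u : G) : option 'I_k := omap c (insub [set v; u]).

Lemma ecolC v u : ecol v u = ecol u v.
Proof. by rewrite /ecol setUC. Qed.

Lemma ecol_edge v u : v -- u ->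
  exists2 A : edge G, val A = [set v; u] & ecol v u = Some (c A).
Proof.
move=> vu; have Ae : [set v; u] \in edges G.
  by rewrite inE; apply/existsP; exists v; apply/existsP; exists u; rewrite vu /=.
by exists (Sub [set v; u] Ae); rewrite ?SubK // /ecol insubT.
Qed.

Lemma color_countE v i : color_count c v i = count_mem (Some i) (seen ecol v).
Proof.
transitivity #|[set u in nb v | ecol v u == Some i]|; last first.
  rewrite count_map -size_filter cardE; apply: perm_size.
  apply: uniq_perm => [||u]; rewrite ?enum_uniq ?(filter_uniq _ (enum_uniq _)) //.
  by rewrite mem_enum mem_filter mem_enum /= !inE andbC.
rewrite /color_count -(card_imset _ val_inj).
rewrite -(card_in_imset (f := fun u => [set v; u])); last first.
  move=> u w; rewrite !inE => /andP[vu _] /andP[vw _] /setP/(_ u).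
  rewrite !inE eqxx orbT; case: eqP vu => [->|_ _ /esym/eqP //].
  by rewrite adj_irrefl.
congr #|pred_of_set _|; apply/setP => B; apply/imsetP/imsetP.
  move=> [A]; rewrite inE => /andP[vA cA] ->.
  have := valP A; rewrite inE => /existsP[x /existsP[y /andP[xy /eqP Axy]]].
  have [u vu Au] : exists2 u, v -- u & val A = [set v; u].
    move: vA; rewrite Axy !inE => /orP[] /eqP->; first by exists y.
    by exists x; rewrite 1?adj_sym // setUC.
  exists u => //; rewrite !inE vu /=.
  have [A' A'u ->] := ecol_edge vu.
  by have /val_inj-> : val A' = val A by rewrite A'u.
move=> [u]; rewrite !inE => /andP[vu cu] ->.
have [A Au eA] := ecol_edge vu; exists A => //.
by rewrite inE Au !inE eqxx /=; move: cu; rewrite eA => /eqP[->].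
Qed.

(** Both vectors have [k] entries, so equal vectors have equally many zeros and hence equally many
    colours; conversely the number of colours fixes the partition of 3. *)
Lemma eq_cstar u v : (cstar c u == cstar c v) = (ncol ecol u == ncol ecol v).
Proof.
have seenN w : None \notin seen ecol w.
  apply/mapP => -[x]; rewrite mem_enum inE => wx.
  by have [A _ ->] := ecol_edge wx.
have seen3 w : size (seen ecol w) = 3 by rewrite size_map -cardE Greg.
have cbarE w : cbar c w = [seq count_mem (Some i) (seen ecol w) | i <- enum 'I_k].
  by apply: eq_map => i; rewrite color_countE.
have sortP s t : (sort geq s == sort geq t) = perm_eq s t.
  apply/eqP/idP => [st|/perm_sortP].
    by rewrite -(perm_sort geq) st perm_sort.
  apply => [x y|y x z xy yz|x y /andP[xy yx]]; first exact: leq_total.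
    exact: leq_trans yz xy.
  by apply/eqP; rewrite eqn_leq; apply/andP.
rewrite sortP !cbarE.
have [/permPl-> leu] := count_enum_perm (seenN u).
have [/permPr-> lev] := count_enum_perm (seenN v).
apply/idP/eqP => [/permP/(_ (pred1 0))|uv].
  have cnt0 w : count_mem 0 [seq count_mem j (seen ecol w)
                            | j <- undup (seen ecol w)] = 0.
    apply/count_memPn/mapP => -[j]; rewrite mem_undup => jw /esym/count_memPn.
    by rewrite jw.
  rewrite !count_cat !cnt0 !count_nseq /= !mul1n => /eqP.
  by rewrite eqn_sub2lE // => /eqP.
rewrite /ncol in uv; rewrite uv perm_cat2r.
have /permPl-> := count_undup3 (seen3 u).
by have /permPr-> := count_undup3 (seen3 v); rewrite uv.
Qed.

End ColorCounts.

(** * Finite combinatorics with three values *)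

(** [option bool] is the three-element set used both for colours and for types. The fixed order of
    preference makes the choice symmetric in [a] and [b], so that an edge gets the same colour from
    either endpoint. *)
Definition avoid (a b : option bool) : option bool :=
  head None [seq c <- [:: None; Some true; Some false] | (c != a) && (c != b)].

Lemma avoidC a b : avoid a b = avoid b a.
Proof. by case: a b => [[]|] [[]|]. Qed.

Lemma avoidl a b : avoid a b != a.
Proof. by case: a b => [[]|] [[]|]. Qed.

(* In any finite set some element has at most one preimage, so the graph of a
   function is 2-degenerate. *)
Lemma functional_3coloring (T : finType) (f : T -> T) :
  exists g : T -> option bool, forall x, f x != x -> g x != g (f x).
Proof.
suff gen (S : {set T}) : exists g : T -> option bool, forall x,
    x \in S -> f x \in S -> f x != x -> g x != g (f x).
  by have [g gP] := gen [set: T]; exists g => x; apply: gP; rewrite inE.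
have [n] := ubnP #|S|; elim: n S => // n IH S; rewrite ltnS => leS.
have [S0|[x0 x0S]] := set_0Vmem S.
  by exists (fun=> None) => x; rewrite S0 inE.
(* If [S] lies in its own image, counting makes [f] injective on [S]; otherwise an element of [S]
   outside the image has no preimage in [S]. *)
have [x xS xpre] : exists2 x, x \in S & forall y z, y \in S -> z \in S ->
    f y = x -> f z = x -> y = z.
  have [sS|/subsetPn[x xS xN]] := boolP (S \subset f @: S).
    have fI : {in S &, injective f}.
      by apply/imset_injP; rewrite eqn_leq leq_imset_card subset_leq_card.
    by exists x0 => // y z yS zS <- /fI->.
  by exists x => // y z yS _ fy; move: xN; rewrite -fy imset_f.
have [|g gP] := IH (S :\ x); first by rewrite (cardsD1 x) xS in leS.
(* The constraints on [x] come from [f x] and from its only possible preimage [y]; without a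
   preimage the default merely avoids one value more. *)
pose y := odflt x [pick y | [&& y \in S, y != x & f y == x]].
exists (fun z => if z == x then avoid (g (f x)) (g y) else g z) => z zS fzS fz.
have [zx|zx] := eqVneq z x; have [fzx|fzx] := eqVneq (f z) x.
- by rewrite fzx zx eqxx in fz.
- by rewrite zx avoidl.
- suff -> : y = z by rewrite eq_sym avoidC avoidl.
  rewrite /y; case: pickP => [y' /and3P[y'S _ /eqP fy']|/(_ z)] /=.
    exact: xpre y'S zS fy' fzx.
  by rewrite zS zx fzx eqxx.
- by apply: gP; rewrite // !inE ?zx ?fzx.
Qed.

Lemma connect_crossing (T : finType) (e : rel T) (U : {set T}) (a b : T) :
  connect e a b -> a \in U -> b \notin U ->
  exists u v, [/\ u \in U, v \notin U & e u v].
Proof.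
move=> /connectP[p]; elim: p a => [|c p IH] a /=; first by move=> _ -> aU; rewrite aU.
move=> /andP[ac pc] bE aU bU; have [cU|cU] := boolP (c \in U); first exact: IH pc bE cU bU.
by exists a, c.
Qed.

Lemma even_involution (T : finType) (A : {set T}) (f : T -> T) :
  involutive f -> {in A, forall x, (f x \in A) && (f x != x)} -> ~~ odd #|A|.
Proof.
move=> fK fA; pose B := [set x in A | enum_rank x < enum_rank (f x)].
have fB : f @: B = A :\: B.
  apply/setP => x; apply/imsetP/idP => [[y]|].
    rewrite inE => /andP[yA lt] ->; have /andP[fyA _] := fA y yA.
    by rewrite !inE fyA fK ltnNge (ltnW lt).
  rewrite !inE negb_and => /andP[/orP[/negPf->//|]]; rewrite -leqNgt => le xA.
  have /andP[fxA nfx] := fA x xA; exists (f x); rewrite ?fK // inE fxA fK ltn_neqAle le.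
  by rewrite andbT; apply: contra nfx => /eqP/val_inj/enum_rank_inj->.
rewrite -(cardsID B A) -fB (card_imset _ (can_inj fK)).
have /setIidPr-> : B \subset A by apply/subsetP => x; rewrite inE => /andP[].
by rewrite addnn odd_double.
Qed.

Lemma size_undup3_perm (K : eqType) (a b c : K) :
  size (undup [:: a; b; c]) = size (undup [:: b; a; c]).
Proof.
apply/perm_size/perm_undup => i; rewrite !inE.
by case: (i == a); case: (i == b).
Qed.

(** A list colouring of a triangle: each vertex has two allowed types, and such a colouring exists
    as soon as the three lists are not all equal. *)
Lemma avoiding_types (a b c : option bool) : a != c ->
  exists p q s, [/\ uniq [:: p; q; s], p != a, q != b & s != c].
Proof.
case: a b c => [[]|] [[]|] [[]|] // _;
first [ by exists None, (Some true), (Some false)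
      | by exists None, (Some false), (Some true)
      | by exists (Some true), None, (Some false)
      | by exists (Some true), (Some false), None
      | by exists (Some false), None, (Some true)
      | by exists (Some false), (Some true), None ].
Qed.

(** * Neighbourhoods and diamonds in cubic graphs *)

Lemma adj_neq (G : sgraph) (x y : G) : x -- y -> x != y.
Proof. by apply: contraTneq => ->; rewrite adj_irrefl. Qed.

Lemma nb3 (G : sgraph) (v a b c : G) : regular_graph G 3 ->
  v -- a -> v -- b -> v -- c -> uniq [:: a; b; c] ->
  forall u, v -- u = (u \in [:: a; b; c]).
Proof.
move=> Greg va vb vc U u.
have /setP/(_ u) : [set x in [:: a; b; c]] = [set x | v -- x].
  apply/eqP; rewrite eqEcard Greg cardsE (card_uniqP U) leqnn andbT.
  by apply/subsetP => x; rewrite !inE => /or3P[] /eqP->.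
by rewrite !inE => ->.
Qed.

Lemma diamondC (G : sgraph) (x y z w : G) : diamond x y z w = diamond x z y w.
Proof.
rewrite /diamond (adj_sym z y); case: (x != w) => //=.
by case: (x -- y); case: (x -- z); case: (y -- z); case: (y -- w); case: (z -- w).
Qed.

Lemma diamond_rev (G : sgraph) (x y z w : G) : diamond x y z w = diamond w y z x.
Proof.
rewrite /diamond (eq_sym w x) ![w -- _]adj_sym ![_ -- x]adj_sym.
by case: (x != w); case: (x -- y); case: (x -- z); case: (y -- z);
   case: (y -- w); case: (z -- w).
Qed.

Lemma ncol_bounds (G : sgraph) (K : eqType) (f : G -> G -> K) (v : G) :
  regular_graph G 3 -> 0 < ncol f v <= 3.
Proof.
move=> Greg; have s3 : size (seen f v) = 3 by rewrite size_map -cardE Greg.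
rewrite /ncol -[3]s3 size_undup andbT.
by case: (seen f v) s3 => // a s _; rewrite -has_predT; apply/hasP; exists a;
   rewrite // mem_undup inE eqxx.
Qed.

(* If both ends saw one colour only, the two middle vertices would see the
   same colours. *)
Lemma diamond_ncol (G : sgraph) (K : eqType) (f : G -> G -> K) (x y z w : G) :
  regular_graph G 3 -> (forall u v : G, f u v = f v u) ->
  (forall u v : G, u -- v -> ncol f u != ncol f v) ->
  diamond x y z w -> ncol f w = ncol f x /\ ncol f x != 1.
Proof.
move=> Greg fC fP D; have /and5P[xw xy xz yz /andP[yw zw]] := D.
have xwE : ncol f w = ncol f x.
  move: (fP _ _ xy) (fP _ _ xz) (fP _ _ yz) (fP _ _ yw) (fP _ _ zw).
  move: (ncol_bounds f x Greg) (ncol_bounds f y Greg).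
  move: (ncol_bounds f z Greg) (ncol_bounds f w Greg).
  by case: (ncol f x) (ncol f y) (ncol f z) (ncol f w)
    => [|[|[|[|]]]] // [|[|[|[|]]]] // [|[|[|[|]]]] // [|[|[|[|]]]].
split=> //; apply/negP => x1; have w1 : ncol f w == 1 by rewrite xwE.
have mono (v a b : G) : ncol f v == 1 -> v -- a -> v -- b -> f v a = f v b.
  move=> v1 va vb; have ain : f v a \in undup (seen f v).
    by rewrite mem_undup map_f // mem_enum inE.
  have bin : f v b \in undup (seen f v).
    by rewrite mem_undup map_f // mem_enum inE.
  move: v1 ain bin; rewrite /ncol; case: (undup _) => [|c [|]] //= _.
  by rewrite !inE => /eqP-> /eqP->.
have [yx zx zy] : [/\ y -- x, z -- x & z -- y] by split; rewrite adj_sym.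
have wy : w -- y by rewrite adj_sym.
have wz : w -- z by rewrite adj_sym.
have Ny : forall u, y -- u = (u \in [:: x; w; z]).
  by apply: nb3; rewrite // /= !inE negb_or xw (adj_neq xz) eq_sym (adj_neq zw).
have Nz : forall u, z -- u = (u \in [:: x; w; y]).
  by apply: nb3; rewrite // /= !inE negb_or xw (adj_neq xy) eq_sym (adj_neq yw).
have /negP[] := fP _ _ yz; rewrite (ncol3 f Ny) (ncol3 f Nz).
rewrite (fC y x) (fC z x) (fC y w) (fC z w) (fC y z).
by rewrite (mono x y z) // (mono w y z).
Qed.

(** * External edges, diamonds and isolated triangles *)

Section Structure.
Variable G : sgraph.

(* The edges in no triangle form a matching; [ext] fixes the middle vertices
   of diamonds, which are on no such edge. *)
Definition bare (v u : G) : bool :=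
  (v -- u) && [forall t, ~~ ((v -- t) && (t -- u))].

Definition ext (v : G) : G := odflt v [pick u | bare v u].

Definition inner (v u : G) : bool := (v -- u) && (u != ext v).

Definition dend (x : G) : bool :=
  [exists y, exists z, exists w, diamond x y z w].

(* The vertices in no diamond: those of the isolated triangles. *)
Definition tri (v : G) : bool := (ext v != v) && ~~ dend v.

Lemma bareC v u : bare v u = bare u v.
Proof.
rewrite /bare (adj_sym v u); congr (_ && _); apply: eq_forallb => t.
by rewrite (adj_sym v t) (adj_sym t u) andbC.
Qed.

Lemma bare_tri (v a b : G) : v -- a -> v -- b -> a -- b -> ~~ bare v a.
Proof.
move=> va vb ab; apply/negP => /andP[_ /forallP/(_ b)].
by rewrite vb adj_sym ab.
Qed.

Lemma dendP x : reflect (exists y z w, diamond x y z w) (dend x).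
Proof.
apply: (iffP existsP) => -[y].
  by move=> /existsP[z /existsP[w D]]; exists y, z, w.
by move=> [z [w D]]; exists y; apply/existsP; exists z; apply/existsP; exists w.
Qed.

Hypothesis Greg : regular_graph G 3.
Hypothesis Gtri : forall v : G, in_triangle v.

Lemma triangle_nb (v : G) : exists a b c, [/\ a -- b, uniq [:: a; b; c] &
  forall u, v -- u = (u \in [:: a; b; c])].
Proof.
have [a [b /and3P[va ab bv]]] := Gtri v.
have vb : v -- b by rewrite adj_sym.
have : 2 < #|[set u | v -- u]| by rewrite Greg.
case: (pickP (fun c => [&& v -- c, c != a & c != b])) => [c /and3P[vc ca cb] _|Nc].
  have U : uniq [:: a; b; c].
    by rewrite /= !inE negb_or (adj_neq ab) !(eq_sym _ c) ca cb.
  by exists a, b, c; split=> //; apply: nb3.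
rewrite ltnNge => /negP[]; apply: leq_trans (subset_leq_card _) (_ : #|[set a; b]| <= 2).
  apply/subsetP => c; have := Nc c; rewrite !inE => /=.
  by case: (v -- c) => //=; case: (c == a) => //= /negbFE.
by rewrite cards2; case: (a != b).
Qed.

(** Two of the three edges at [v] lie in a triangle, so at most one can be bare. *)
Lemma bare_ext v u : bare v u -> ext v = u.
Proof.
have [a [b [c [ab U nbv]]]] := triangle_nb v.
have va : v -- a by rewrite nbv !inE eqxx.
have vb : v -- b by rewrite nbv !inE eqxx !orbT.
have Na := bare_tri va vb ab.
have Nb : ~~ bare v b by rewrite (bare_tri vb va) // adj_sym.
have bc w : bare v w -> w = c.
  move=> vw; have /andP[] := vw; rewrite nbv !inE => /or3P[] /eqP wE _ //;
  by rewrite wE ?(negPf Na) ?(negPf Nb) in vw.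
rewrite /ext => vu; case: pickP => [w vw|/(_ u)]; last by rewrite vu.
by rewrite /= (bc _ vw) (bc _ vu).
Qed.

Lemma ext_bare v : ext v != v -> bare v (ext v).
Proof. by rewrite /ext; case: pickP => //=; rewrite eqxx. Qed.

Lemma extK v : ext (ext v) = v.
Proof.
have [vE|vE] := eqVneq (ext v) v; first by rewrite !vE.
by apply: bare_ext; rewrite bareC ext_bare.
Qed.

Lemma ext_inj : injective ext.
Proof. exact: can_inj extK. Qed.

Lemma ext_eq v : (ext (ext v) == ext v) = (ext v == v).
Proof. by rewrite extK eq_sym. Qed.

Lemma adj_ext v : ext v != v -> v -- ext v.
Proof. by move=> /ext_bare/andP[]. Qed.

Lemma innerC v u : inner v u = inner u v.
Proof. by rewrite /inner adj_sym (eq_sym v) (can2_eq extK extK). Qed.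

Lemma adj_inner (v u : G) : v -- u -> (u == ext v) || inner v u.
Proof. by rewrite /inner => ->; case: (u == ext v). Qed.

Lemma triangle_inner (v a b : G) : v -- a -> v -- b -> a -- b -> inner v a.
Proof.
move=> va vb ab; rewrite /inner va; apply: contra (bare_tri va vb ab) => /eqP aE.
by rewrite aE ext_bare // -aE eq_sym adj_neq.
Qed.

Lemma triangle_nbE (v a b : G) : ext v != v -> v -- a -> v -- b -> a -- b ->
  uniq [:: a; b; ext v] /\ forall u, v -- u = (u \in [:: a; b; ext v]).
Proof.
move=> vE va vb ab.
have /andP[_ aE] := triangle_inner va vb ab.
have /andP[_ bE] : inner v b by apply: triangle_inner vb va _; rewrite adj_sym.
have U : uniq [:: a; b; ext v] by rewrite /= !inE negb_or aE bE adj_neq.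
by split=> //; apply: nb3; rewrite // adj_ext.
Qed.

(** Let [a], [b] form a triangle with [v]. The edge to the third neighbour [c] is not bare, so [c]
    is adjacent to [a] or [b], which gives a second triangle at [v]. *)
Lemma mid_diamond v : ext v = v -> exists x z w, diamond x v z w.
Proof.
have [a [b [c [ab U nbv]]]] := triangle_nb v => vE.
have [va vb vc] : [/\ v -- a, v -- b & v -- c].
  by rewrite !nbv !inE !eqxx !orbT.
move: U; rewrite /= !inE negb_or => /andP[/andP[nab nac] /andP[nbc _]].
have [ca|Nca] := boolP (c -- a).
  by exists b, a, c; rewrite /diamond nbc vc va [b -- v]adj_sym vb [b -- a]adj_sym ab [a -- c]adj_sym ca.
have [cb|Ncb] := boolP (c -- b).
  by exists a, b, c; rewrite /diamond nac vc vb [a -- v]adj_sym va ab [b -- c]adj_sym cb.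
suff /bare_ext cE : bare v c by have := adj_neq vc; rewrite -cE vE eqxx.
rewrite /bare vc; apply/forallP => t; rewrite nbv !inE.
apply/negP => /andP[/or3P[] /eqP->];
  by rewrite ?adj_irrefl // adj_sym ?(negPf Nca) ?(negPf Ncb).
Qed.

Hypothesis noK4 : forall x y z w : G, diamond x y z w -> ~~ (x -- w).

Lemma diamond_mid (x y z w : G) : diamond x y z w ->
  [/\ ext y = y, ext z = z,
      forall u, y -- u = (u \in [:: x; z; w]) &
      forall u, z -- u = (u \in [:: x; y; w])].
Proof.
move=> D; have /and5P[xw xy xz yz /andP[yw zw]] := D.
have [yx zx zy] : [/\ y -- x, z -- x & z -- y] by split; rewrite adj_sym.
have Ny u : y -- u = (u \in [:: x; z; w]).
  by apply: nb3; rewrite // /= !inE negb_or xw (adj_neq xz) (adj_neq zw).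
have Nz u : z -- u = (u \in [:: x; y; w]).
  by apply: nb3; rewrite // /= !inE negb_or xw (adj_neq xy) (adj_neq yw).
split=> //; apply/eqP; apply/negPn/negP => /ext_bare B; have /andP[] := B.
  rewrite Ny !inE => /or3P[] /eqP E; move: B; rewrite E.
  - by rewrite (negPf (bare_tri yx yz xz)).
  - by rewrite (negPf (bare_tri yz yx zx)).
  - by rewrite bareC (negPf (bare_tri _ _ yz)) // adj_sym.
rewrite Nz !inE => /or3P[] /eqP E; move: B; rewrite E.
- by rewrite (negPf (bare_tri zx zy xy)).
- by rewrite (negPf (bare_tri zy zx yx)).
- by rewrite bareC (negPf (bare_tri _ _ zy)) // adj_sym.
Qed.

(** This is where [noK4] enters: if the third neighbour of [x] were [w], the edge to it would lie in
    a triangle and [x] would have no external edge. *)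
Lemma diamond_end (x y z w : G) : diamond x y z w ->
  [/\ ext x != x, ext x \notin [:: x; y; z; w], uniq [:: y; z; ext x] &
      forall u, x -- u = (u \in [:: y; z; ext x])].
Proof.
move=> D; have /and5P[xw xy xz yz /andP[yw zw]] := D.
have [_ _ Ny Nz] := diamond_mid D.
have xE : ext x != x.
  have [o xo /andP[oy oz]] : exists2 o, x -- o & (o != y) && (o != z).
    apply/exists_inP; apply: contraT; rewrite negb_exists_in => /forall_inP H.
    have : #|[set y; z]| < #|[set u | x -- u]|.
      by rewrite Greg cards2; case: (y != z).
    rewrite ltnNge => /negP[]; apply/subset_leq_card/subsetP => u.
    by rewrite !inE => /H; rewrite negb_and !negbK.
  suff /bare_ext-> : bare x o by rewrite eq_sym adj_neq.
  rewrite /bare xo; apply/forallP => t; apply/negP => /andP[xt to'].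
  have U' : uniq [:: y; z; o] by rewrite /= !inE negb_or (adj_neq yz) !(eq_sym _ o) oy oz.
  have := nb3 Greg xy xz xo U' t; rewrite xt !inE => /esym/or3P[] /eqP E;
    move: to'; rewrite E ?Ny ?Nz ?adj_irrefl // !inE => /or3P[] /eqP oE.
  - by rewrite oE adj_irrefl in xo.
  - by rewrite oE eqxx in oz.
  - by move: xo (noK4 D); rewrite oE => ->.
  - by rewrite oE adj_irrefl in xo.
  - by rewrite oE eqxx in oy.
  - by move: xo (noK4 D); rewrite oE => ->.
have [U nbx] := triangle_nbE xE xy xz yz; split=> //.
rewrite !inE !negb_or xE /=; move: U; rewrite /= !inE negb_or !(eq_sym _ (ext x)).
move=> /and3P[/andP[_ ->] -> _] /=.
by apply: contraTneq (adj_ext xE) => ->; apply: noK4 D.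
Qed.

Lemma diamond_ends x y z w : diamond x y z w -> dend x && dend w.
Proof.
move=> D; apply/andP; split; apply/dendP; exists y, z; [exists w|exists x] => //.
by rewrite -diamond_rev.
Qed.

Lemma dend_ext x : dend x -> ext x != x.
Proof. by move=> /dendP[y [z [w /diamond_end[]]]]. Qed.

Lemma dend_adj (x y : G) : dend x -> dend y -> x -- y -> ext x = y.
Proof.
move=> /dendP[a [b [w D]]] /dend_ext yE; have [_ _ _ ->] := diamond_end D.
have [aE bE _ _] := diamond_mid D.
by rewrite !inE => /or3P[] /eqP H //; move: yE; rewrite H ?aE ?bE eqxx.
Qed.

(** The middle vertices must be the only two inner neighbours of [x], and the neighbours of a middle
    vertex leave one choice for the other end. *)
Lemma diamond_from_end (x y z w y' z' w' : G) :
  diamond x y z w -> diamond x y' z' w' ->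
  w' = w /\ (y' = y /\ z' = z \/ y' = z /\ z' = y).
Proof.
move=> D D'; have [_ _ _ nbx] := diamond_end D.
have [_ _ Ny Nz] := diamond_mid D.
have /and5P[xw' xy' xz' yz' /andP[yw' zw']] := D'.
have zy' : z' -- y' by rewrite adj_sym.
have /andP[_ yE'] := triangle_inner xy' xz' yz'.
have /andP[_ zE'] := triangle_inner xz' xy' zy'.
move: xy' xz'; rewrite !nbx !inE (negPf yE') (negPf zE') !orbF.
move: (adj_neq yz') (adj_neq zw') yw'.
move=> nyz nzw yw' /orP[] /eqP Ey /orP[] /eqP Ez;
  move: nyz nzw yw'; rewrite Ey Ez ?eqxx // ?Ny ?Nz !inE (eq_sym w') (negPf xw') => _ /negPf;
  by rewrite (eq_sym _ w') => -> /eqP->; split=> //; first [by left | by right].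
Qed.

(** A diamond is the closed neighbourhood of either of its middle vertices, and it is determined by
    either of its ends. *)
Lemma diamond_meet (x y z w x' y' z' w' u : G) :
  diamond x y z w -> diamond x' y' z' w' ->
  u \in [:: x; y; z; w] -> u \in [:: x'; y'; z'; w'] ->
  {subset [:: x'; y'; z'; w'] <= [:: x; y; z; w]}.
Proof.
have from_end (a b c d b' c' d' : G) : diamond a b c d -> diamond a b' c' d' ->
    [:: a; b'; c'; d'] =i [:: a; b; c; d].
  move=> D D'; have [-> [[-> ->]|[-> ->]]] := diamond_from_end D D' => // v.
  by rewrite !inE; case: (v == b); case: (v == c); rewrite ?orbT.
have dE (a b c d : G) : diamond a b c d -> [:: a; b; c; d] =i b |: nb b.
  by move=> /diamond_mid[_ _ Nb _] v; rewrite !inE Nb !inE; case: (v == b);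
     case: (v == a).
have dC (a b c d : G) : [:: a; b; c; d] =i [:: a; c; b; d].
  by move=> v; rewrite !inE; case: (v == b); case: (v == c); rewrite ?orbT.
have dR (a b c d : G) : [:: a; b; c; d] =i [:: d; b; c; a].
  move=> v; rewrite !inE; case: (v == a); case: (v == b); case: (v == c);
  by case: (v == d).
move=> D D' uD uD'.
have [uE|uE] := eqVneq (ext u) u.
  have du a b c d : diamond a b c d -> u \in [:: a; b; c; d] ->
      [:: a; b; c; d] =i u |: nb u.
    move=> Da; have Da' := Da; rewrite diamondC in Da'.
    have [aE _ _ _] := diamond_end Da.
    have dE' : ext d != d.
      by move: (Da); rewrite diamond_rev => /diamond_end[].
    rewrite !inE => /or4P[] /eqP H v.
    - by rewrite -H uE eqxx in aE.
    - by rewrite (dE _ _ _ _ Da) H.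
    - by rewrite dC (dE _ _ _ _ Da') H.
    - by rewrite -H uE eqxx in dE'.
  by move=> v; rewrite (du _ _ _ _ D uD) (du _ _ _ _ D' uD').
have du a b c d : diamond a b c d -> u \in [:: a; b; c; d] ->
    exists b' c' d', diamond u b' c' d' /\ [:: a; b; c; d] =i [:: u; b'; c'; d'].
  move=> Da; have [bE cE _ _] := diamond_mid Da; rewrite !inE => /or4P[] /eqP H.
  - by rewrite H; exists b, c, d.
  - by rewrite H bE eqxx in uE.
  - by rewrite H cE eqxx in uE.
  - by rewrite H; exists b, c, a; rewrite -diamond_rev.
have [b [c [d [E e]]]] := du _ _ _ _ D' uD'.
have [b' [c' [d' [E' e']]]] := du _ _ _ _ D uD.
by move=> v; rewrite e e' (from_end _ _ _ _ _ _ _ E' E).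
Qed.

Lemma not_tri_diamond (v : G) : ~~ tri v ->
  exists x y z w, diamond x y z w /\ v \in [:: x; y; z; w].
Proof.
rewrite /tri negb_and !negbK => /orP[/eqP/mid_diamond[x [z [w D]]]|].
  by exists x, v, z, w; rewrite !inE eqxx orbT.
by move=> /dendP[y [z [w D]]]; exists v, y, z, w; rewrite !inE eqxx.
Qed.

Lemma tri_not_diamond (v x y z w : G) : tri v -> diamond x y z w ->
  v \notin [:: x; y; z; w].
Proof.
move=> /andP[vE vD] D; have [yE zE _ _] := diamond_mid D.
have /andP[xD wD] := diamond_ends D.
apply: contraNN vD; rewrite !inE => /or4P[] /eqP H; rewrite H //.
- by rewrite H yE eqxx in vE.
- by rewrite H zE eqxx in vE.
Qed.

Lemma tri_inner (v a : G) : tri v -> inner v a -> tri a.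
Proof.
move=> tv va; apply: contraT => /not_tri_diamond[x [y [z [w [D aD]]]]].
have := tri_not_diamond tv D; rewrite !inE => /negP[]; move: va.
have [yE zE Ny Nz] := diamond_mid D.
have [_ _ _ nbx] := diamond_end D.
have nbw u : w -- u = (u \in [:: y; z; ext w]).
  by move: (D); rewrite diamond_rev => /diamond_end[].
rewrite innerC => /andP[av vE]; move: aD vE av.
rewrite !inE => /or4P[] /eqP->; rewrite ?Ny ?Nz ?nbx ?nbw !inE.
- by move=> /negPf->; rewrite orbF => /orP[] ->; rewrite ?orbT.
- by move=> _ /or3P[] ->; rewrite ?orbT.
- by move=> _ /or3P[] ->; rewrite ?orbT.
- by move=> /negPf->; rewrite orbF => /orP[] ->; rewrite ?orbT.
Qed.

Lemma tri_triangle (v : G) : tri v -> exists a b, [/\ inner v a, inner v b,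
  a -- b, uniq [:: a; b; ext v] & forall u, v -- u = (u \in [:: a; b; ext v])].
Proof.
move=> /andP[vE _]; have [a [b /and3P[va ab bv]]] := Gtri v.
have vb : v -- b by rewrite adj_sym.
have ba : b -- a by rewrite adj_sym.
have [U nbv] := triangle_nbE vE va vb ab.
by exists a, b; split=> //; [apply: triangle_inner vb _|apply: triangle_inner va _].
Qed.

Definition opp (v : G) : G :=
  odflt v [pick w | [exists y, exists z, diamond v y z w]].

Lemma oppE (x y z w : G) : diamond x y z w -> opp x = w.
Proof.
move=> D; rewrite /opp; case: pickP => [w' /existsP[y' /existsP[z' D']]|/(_ w)].
  by have [] := diamond_from_end D D'.
by have -> // : [exists y, exists z, diamond x y z w];
   apply/existsP; exists y; apply/existsP; exists z.
Qed.

(** * Edge-colourings realising given types *)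

Section Types.
Variable tau : G -> option bool.
Hypothesis tau_proper : forall u v : G, u -- v -> tau u != tau v.
Hypothesis tau_dend : forall x : G, dend x -> tau x != None.

(* The types of vertices seeing 1, 2 and 3 colours are encoded by [None],
   [Some true] and [Some false]; [vert t v] is the vertex of type [t] in the
   isolated triangle of [v]. *)
Definition vert (t : option bool) (v : G) : G :=
  odflt v [pick s | (tau s == t) && ((s == v) || inner v s)].

Lemma tri_clique (v s u : G) : tri v ->
  (s == v) || inner v s -> (u == v) || inner v u -> s != u -> s -- u.
Proof.
move=> /tri_triangle[a [b [_ _ ab _ nbv]]].
have iE t : inner v t -> (t == a) || (t == b).
  by move=> /andP[]; rewrite nbv !inE => /or3P[] ->; rewrite ?orbT.
have ba : b -- a by rewrite adj_sym.
case/predU1P => [->|sv]; case/predU1P => [->|uv]; rewrite ?eqxx //.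
- by case/andP: uv.
- by rewrite adj_sym; case/andP: sv.
by move: (iE _ sv) (iE _ uv) => /orP[] /eqP-> /orP[] /eqP->; rewrite ?eqxx.
Qed.

Lemma vertE (v u : G) : tri v -> (u == v) || inner v u -> vert (tau u) v = u.
Proof.
move=> tv uv; rewrite /vert; case: pickP => [s /andP[/eqP su sv]|/(_ u)] /=.
  have [//|nsu] := eqVneq s u; have := tau_proper (tri_clique tv sv uv nsu).
  by rewrite su eqxx.
by rewrite eqxx uv.
Qed.

Lemma tau_opp (x y z w : G) : diamond x y z w -> tau w = tau x.
Proof.
move=> /and5P[_ /tau_proper + /tau_proper + /tau_proper + /andP[/tau_proper + /tau_proper]].
by case: (tau x) (tau y) (tau z) (tau w) => [[]|] [[]|] [[]|] [[]|].
Qed.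

Definition triC (v : G) : bool := tri v && (tau v == Some false).

(** For [t] of type 3 in a triangle, [gam t] will colour the external edge at [t]. If this edge ends
    in another triangle, the type 3 vertex there needs a different external colour; this is the only
    use of the inequality, and its instances at other vertices are harmless. *)
Variable gam : G -> option bool.
Hypothesis gamP : forall t, vert (Some false) (ext t) != t ->
  gam t != gam (vert (Some false) (ext t)).

(* A diamond whose ends see three colours has the same colour on its two
   external edges, so these are coloured together: [far] is the endpoint of
   such a pair of edges. *)
Definition far (v : G) : G :=
  if dend v && (tau v == Some false) then ext (opp v) else v.

(* The colour of the external edge at [v].  In an isolated triangle the vertex
   of type 3 must have an external colour different from the other two; its
   external edge gets the colour [gam], and every other external edge avoids
   the colours [gam] of the triangles it meets. *)
Definition kap (v : G) : option bool :=
  if triC v then gam v else if triC (ext v) then gam (ext v) else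
  avoid (gam (vert (Some false) (far v))) (gam (vert (Some false) (far (ext v)))).

(** The two ends have different types, so at most one of them is a type 3 triangle vertex and the
    branches agree; the last branch is symmetric. *)
Lemma kap_ext v : kap (ext v) = kap v.
Proof.
have [-> //|vE] := eqVneq (ext v) v; have := tau_proper (adj_ext vE).
rewrite /kap extK /triC avoidC.
by case: (tri v); case: (tri (ext v)); case: (tau v) (tau (ext v)) => [[]|] [[]|].
Qed.

(** Both edges avoid the same two values, because the external neighbours of ends of type 3 are not
    of type 3 and the pairing does not propagate further. Equality is needed since the middle vertex
    of type 2 must receive the same [beta] from both ends. *)
Lemma kap_opp (x y z w : G) : diamond x y z w -> tau x = Some false ->
  kap w = kap x.
Proof.
move=> D xC; have wC := tau_opp D.
have D' : diamond w y z x by rewrite -diamond_rev.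
have NC (v v' : G) : dend v -> tau v = Some false -> opp v = v' ->
    kap v = avoid (gam (vert (Some false) (ext v'))) (gam (vert (Some false) (ext v))).
  move=> vD vC vv'; have := tau_proper (adj_ext (dend_ext vD)).
  rewrite /kap /triC /tri vD andbF /= vC eq_sym => /negPf vEC.
  by rewrite vEC andbF /far vD vC vEC /= vv' andbF.
have /andP[xD wD] := diamond_ends D.
by rewrite (NC _ _ wD _ (oppE D')) ?wC // (NC _ _ xD xC (oppE D)) avoidC.
Qed.

(** Either the external edge at [u] leads to a type 3 triangle vertex and carries its [gam], so that
    [gamP] applies, or its colour was chosen to avoid [gam v]. *)
Lemma kap_tri (u v : G) : tri u -> inner u v -> tau v = Some false ->
  kap u != kap v.
Proof.
move=> tu uv vC; have tv := tri_inner tu uv; have /andP[adjuv nvE] := uv.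
have uE : vert (Some false) u = v by rewrite -vC vertE // uv orbT.
have := tau_proper adjuv; rewrite vC => uC.
rewrite {2}/kap /triC tv vC eqxx /= /kap /triC tu (negPf uC) /=.
case: ifP => [_|_]; first by have := @gamP (ext u); rewrite extK uE; apply.
by rewrite {1}/far (negPf uC) andbF uE avoidl.
Qed.

(* The colours of the edges from the end [v] of a diamond to its middle
   vertices of type 1 ([alpha]) and of type 2 or 3 ([beta]). When the external
   colours agree at two ends of type 2, [beta] has to differ between them and
   the symmetry is broken by [enum_rank]. *)
Definition alpha (v : G) : option bool :=
  if tau v == Some false then avoid (kap v) (kap v) else
  if kap v == kap (opp v) then kap v else avoid (kap v) (kap (opp v)).

Definition beta (v : G) : option bool :=
  if tau v == Some false then avoid (kap v) (alpha v) else
  if kap v == kap (opp v) then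
    if enum_rank v < enum_rank (opp v) then avoid (kap v) (kap v)
    else avoid (kap v) (avoid (kap v) (kap v))
  else kap v.

(** Gives the edge between two middle vertices access to the [alpha] of its diamond; the choice of
    end is immaterial by [alpha_opp]. *)
Definition an_end (u : G) : G := odflt u [pick x | dend x && (u -- x)].

Definition col (u v : G) : option bool :=
  if v == ext u then kap u else
  if dend u then if tau v == None then alpha u else beta u else
  if dend v then if tau u == None then alpha v else beta v else
  if ext u == u then alpha (an_end u) else
  if tau u == None then kap u else if tau v == None then kap v else
  avoid (kap (vert None u)) (kap (vert (Some false) u)).

Lemma alpha_opp (x y z w : G) : diamond x y z w -> alpha w = alpha x.
Proof.
move=> D; have D' : diamond w y z x by rewrite -diamond_rev.
rewrite /alpha (tau_opp D) (oppE D) (oppE D').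
case: (eqVneq (tau x)) => [xC|_]; first by rewrite (kap_opp D xC).
by rewrite (eq_sym (kap w)); case: eqP => // _; rewrite avoidC.
Qed.

Lemma mid_not_dend v : ext v = v -> ~~ dend v.
Proof. by move=> vE; apply/negP => /dend_ext; rewrite vE eqxx. Qed.

Lemma alpha_an_end (x y z w : G) : diamond x y z w ->
  alpha (an_end y) = alpha x /\ alpha (an_end z) = alpha x.
Proof.
have gen (a b c d : G) : diamond a b c d -> alpha (an_end b) = alpha a.
  move=> D; rewrite /an_end; case: pickP => [s /andP[sD]|/(_ a)] /=.
    have [_ cE -> _] := diamond_mid D; rewrite !inE => /or3P[] /eqP sE.
    + by rewrite sE.
    + by move: sD; rewrite sE (negPf (mid_not_dend cE)).
    + by rewrite sE (alpha_opp D).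
  have /andP[-> _] := diamond_ends D; have [_ _ -> _] := diamond_mid D.
  by rewrite !inE eqxx.
by move=> D; split; [apply: gen D|move: D; rewrite diamondC; apply: gen].
Qed.

Lemma colC u v : u -- v -> col u v = col v u.
Proof.
move=> uv; have vu : v -- u by rewrite adj_sym.
rewrite /col; have -> : (u == ext v) = (v == ext u).
  by rewrite eq_sym (can2_eq extK extK).
case: (eqVneq v (ext u)) => [->|vE]; first by rewrite kap_ext.
have [uD|uD] := boolP (dend u).
  have [vD|//] := boolP (dend v).
  by move: vE; rewrite (dend_adj uD vD uv) eqxx.
have [//|vD] := boolP (dend v).
case: (eqVneq (ext u) u) => [uE|uE].
  have [x [z [w D]]] := mid_diamond uE.
  have [_ zE Nu _] := diamond_mid D; have [-> az] := alpha_an_end D.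
  have /andP[xD wD] := diamond_ends D.
  have -> : v = z.
    by move: uv; rewrite Nu !inE => /or3P[] /eqP H //; rewrite H ?xD ?wD in vD.
  by rewrite zE eqxx az.
have tu : tri u by rewrite /tri uE uD.
have iuv : inner u v by rewrite /inner uv vE.
have tv := tri_inner tu iuv; have /andP[/negPf-> _] := tv.
have uNv := tau_proper uv.
case: (eqVneq (tau u) None) => [uA|uA]; first by rewrite -uA eq_sym (negPf uNv).
case: (eqVneq (tau v) None) => [//|vA].
(* What remains is the edge between the vertices of types 2 and 3 of an isolated triangle. The third
   vertex [t] has type 1, and [vert] finds the same vertices from [u] as from [v]. *)
have [a [b [ua ub ab U nbu]]] := tri_triangle tu.
have [t ut tuv] : exists2 t, inner u t & t -- v.
  have := uv; rewrite nbu !inE (negPf vE) orbF => /orP[] /eqP->.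
    by exists b; rewrite // adj_sym.
  by exists a.
have vt : inner v t.
  by apply: (triangle_inner (b := u)); rewrite // adj_sym //; case/andP: ut.
have /andP[/tau_proper utN _] := ut.
have same s : s \in [:: u; v; t] -> vert (tau s) u = vert (tau s) v.
  rewrite !inE => /or3P[] /eqP->; rewrite !vertE ?eqxx ?iuv ?ut ?vt ?orbT //.
  by rewrite innerC iuv orbT.
have tA : tau t = None.
  by case: (tau u) (tau v) (tau t) uA vA uNv utN (tau_proper tuv)
     => [[]|] [[]|] [[]|].
have -> : vert None u = vert None v by rewrite -tA same ?inE ?eqxx ?orbT.
have [s sin sC] : exists2 s, s \in [:: u; v; t] & tau s = Some false.
  case uC: (tau u == Some false).
    by exists u; rewrite ?inE ?eqxx //; apply/eqP.
  exists v; rewrite ?inE ?eqxx ?orbT //.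
  by case: (tau u) (tau v) uA vA uNv uC => [[]|] [[]|].
by rewrite -sC same.
Qed.

Definition type_size (t : option bool) : nat :=
  match t with None => 1 | Some true => 2 | Some false => 3 end.

(** Let [p], [q], [r] be the external colours at types 1, 2, 3 and [s] the colour avoiding [p] and
    [r]. Type 1 sees only [p], and type 3 sees [p], [r], [s], all distinct. Type 2 sees [p], [s],
    [q], where [q] differs from [r] and so is [p] or [s]. *)
Lemma ncol_tri v : tri v -> ncol col v = type_size (tau v).
Proof.
move=> tv; have [a [b [va vb ab _ nbv]]] := tri_triangle tv.
have /andP[vE vD] := tv.
(* The first neighbour [c] is the one of type 1, unless [v] itself has type 1. *)
have base c d : inner v c -> inner v d -> c -- d ->
    (tau v == None) || (tau c == None) ->
  size (undup [:: col v c; col v d; col v (ext v)]) = type_size (tau v).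
  move=> vc vd cd; have [tc td] := (tri_inner tv vc, tri_inner tv vd).
  have /andP[avc /negPf cE] := vc; have /andP[avd /negPf dE] := vd.
  have dc : inner d c.
    by rewrite innerC; apply: (triangle_inner (b := v)); rewrite // adj_sym.
  have [/andP[_ /negPf cD] /andP[_ /negPf dD]] := (tc, td).
  rewrite /col cE dE eqxx (negPf vD) cD dD (negPf vE).
  case tvA: (tau v == None); first by rewrite (eqP tvA) /= !inE !eqxx.
  move=> /eqP cA; rewrite cA eqxx.
  have dA : tau d == None = false.
    by apply/negbTE; rewrite -cA eq_sym; apply: tau_proper.
  rewrite dA -{1}cA vertE ?vc ?orbT //.
  have [vC|vC] := eqVneq (tau v) (Some false).
    have := kap_tri (tri_inner tv vc) _ vC; rewrite innerC => /(_ vc).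
    rewrite -vC vertE ?eqxx //= vC /=.
    by case: (kap v) (kap c) => [[]|] [[]|].
  have dC : tau d = Some false.
    have := tau_proper avd; move: tvA dA vC.
    by case: (tau v) (tau d) => [[]|] [[]|].
  have -> : tau v = Some true by move: tvA vC; case: (tau v) => [[]|].
  rewrite -dC vertE ?vd ?orbT //=.
  have := kap_tri tv vd dC; have := kap_tri tc _ dC; rewrite innerC dc => /(_ isT).
  by case: (kap v) (kap c) (kap d) => [[]|] [[]|] [[]|].
rewrite (ncol3 _ nbv).
have [H|] := boolP ((tau v == None) || (tau a == None)); first exact: base.
move=> H; rewrite size_undup3_perm; apply: base; rewrite 1?adj_sym //.
have /andP[/tau_proper + _] := va; have /andP[/tau_proper + _] := vb.
have := tau_proper ab; move: H.
by case: (tau v) (tau a) (tau b) => [[]|] [[]|] [[]|].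
Qed.

Lemma ncol_dend x : dend x -> ncol col x = type_size (tau x).
Proof.
move=> xD; have := xD => /dendP[y [z [w D]]].
wlog yA : y z D / tau y = None.
  have /and5P[_ /tau_proper + /tau_proper + /tau_proper + _] := D => H1 H2 H3 H.
  have [yA|yA] := eqVneq (tau y) None; first exact: H D yA.
  have D' := D; rewrite diamondC in D'; apply: H D' _.
  move: (tau_dend xD) H1 H2 H3 yA.
  by case: (tau x) (tau y) (tau z) => [[]|] [[]|] [[]|].
have [_ _ U nbx] := diamond_end D.
move: U; rewrite /= !inE negb_or => /and3P[/andP[_ yE] zE _].
have zA : tau z == None = false.
  by apply/negbTE; rewrite -yA eq_sym; have /and5P[_ _ _ /tau_proper] := D.
rewrite (ncol3 _ nbx) /col eqxx (negPf yE) (negPf zE) xD yA zA eqxx.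
have := tau_dend xD; rewrite /beta /alpha.
case: (tau x) => [[]|] // _; last by case: (kap x) => [[]|].
rewrite (_ : (Some true == Some false) = false) //.
case: (eqVneq (kap x) (kap (opp x))) => [_|].
  by case: ifP => _; case: (kap x) => [[]|].
by case: (kap x) (kap (opp x)) => [[]|] [[]|].
Qed.

(** The middle vertices have type 1 and one other type. If the ends have type 2, the other middle
    vertex must see three colours: for equal external colours [alpha] is that colour and the two
    [beta] are the remaining ones; for different external colours these serve as [beta] and [alpha]
    is the third. *)
Lemma ncol_mid y : ext y = y -> ncol col y = type_size (tau y).
Proof.
move=> yE; have [x [z [w D]]] := mid_diamond yE.
have [_ zE Ny _] := diamond_mid D; have /andP[xD wD] := diamond_ends D.
have [ay _] := alpha_an_end D; have aw := alpha_opp D; have tw := tau_opp D.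
have D' : diamond w y z x by rewrite -diamond_rev.
have /and5P[nxw axy axz ayz /andP[ayw azw]] := D.
have neq (u : G) : y -- u -> (u == ext y) = false.
  by move=> yu; rewrite yE eq_sym; apply/negbTE/adj_neq.
rewrite (ncol3 _ Ny) /col !neq //; last by rewrite adj_sym.
rewrite (negPf (mid_not_dend yE)) (negPf (mid_not_dend zE)) xD wD yE eqxx ay aw.
case yA: (tau y == None); first by rewrite (eqP yA) /= !inE !eqxx.
have := tau_proper axy; have := tau_dend xD.
rewrite /beta tw aw /alpha (oppE D) (oppE D'); case tx: (tau x) => [[]|] // _.
  have [-> xy|nk xy] := eqVneq (kap x) (kap w).
    have -> : tau y = Some false by move: xy yA; case: (tau y) => [[]|].
    move: nxw; rewrite -(inj_eq enum_rank_inj) -val_eqE neq_ltn /=.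
    by case: ltngtP => // _ _; case: (kap w) => [[]|].
  have -> : tau y = Some false by move: xy yA; case: (tau y) => [[]|].
  by move: nk; case: (kap x) (kap w) => [[]|] [[]|].
move=> xy; have -> : tau y = Some true by move: xy yA; case: (tau y) => [[]|].
by rewrite (kap_opp D tx) /=; case: (kap x) => [[]|].
Qed.

Lemma ncol_type v : ncol col v = type_size (tau v).
Proof.
have [vE|vE] := eqVneq (ext v) v; first exact: ncol_mid.
have [vD|vD] := boolP (dend v); first exact: ncol_dend.
by apply: ncol_tri; rewrite /tri vE.
Qed.

End Types.
Lemma types_colorable (tau : G -> option bool) :
  (forall u v : G, u -- v -> tau u != tau v) ->
  (forall x : G, dend x -> tau x != None) -> color_blind_colorable G 3.
Proof.
move=> tauP tauD.
have [gam gamP] :=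
  functional_3coloring (fun t => vert tau (Some false) (ext t)).
have colS := colC tauP gam; have colT := ncol_type tauP tauD gamP.
move: (col tau gam) colS colT => f fC fT.
pose code (t : option bool) : 'I_3 :=
  match t with None => inord 0 | Some true => inord 1 | Some false => inord 2 end.
have codeI : injective code.
  by move=> [[]|] [[]|] //= /(congr1 val); rewrite /= !inordK.
pose c : edge_coloring G 3 := [ffun A : edge G =>
  if [pick p : G * G | (p.1 -- p.2) && (val A == [set p.1; p.2])] is Some p
  then code (f p.1 p.2) else ord0].
have cE (v u : G) : v -- u -> ecol c v u = (Some \o code) (f v u).
  move=> vu; have [A Au ->] := ecol_edge c vu; rewrite ffunE /= Au.
  case: pickP => [[a b] /= /andP[ab /eqP E]|/(_ (v, u))]; last by rewrite vu /= eqxx.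
  have : (a \in [set v; u]) && (b \in [set v; u]) by rewrite E !inE !eqxx orbT.
  rewrite !inE => /andP[/orP[] /eqP aE /orP[] /eqP bE]; rewrite aE bE //.
  - by move: ab; rewrite aE bE adj_irrefl.
  - by rewrite fC 1?adj_sym.
  - by move: ab; rewrite aE bE adj_irrefl.
apply/existsP; exists c; apply/forallP => u; apply/forallP => v; apply/implyP => uv.
rewrite eq_cstar //.
have codeI' : injective (Some \o code) by move=> s t [] /codeI.
have cT w : ncol (ecol c) w = type_size (tau w).
  by rewrite (eq_ncol codeI' (cE w)) fT.
rewrite !cT.
by have := tauP u v uv; case: (tau u) (tau v) => [[]|] [[]|].
Qed.

Lemma inner_diamond (x y z w u v : G) : diamond x y z w ->
  u \in [:: x; y; z; w] -> inner u v -> v \in [:: x; y; z; w].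
Proof.
move=> D uD /andP[auv vE]; move: uD vE auv.
have [_ _ Ny Nz] := diamond_mid D; have [_ _ _ Nx] := diamond_end D.
have Nw t : w -- t = (t \in [:: y; z; ext w]).
  by move: (D); rewrite diamond_rev => /diamond_end[].
rewrite !inE => /or4P[] /eqP->; rewrite ?Nx ?Ny ?Nz ?Nw !inE => /negPf H;
  by case/or3P => E; first [by rewrite E ?orbT | by rewrite E in H].
Qed.

(** * Greedy typing *)

(** Diamonds are typed in one step, so none is ever only partly typed. *)
Definition diamond_closed (U : {set G}) : Prop :=
  forall (x y z w u : G), diamond x y z w -> u \in [:: x; y; z; w] -> u \in U ->
  {subset [:: x; y; z; w] <= U}.

(* [o] is the matching of external edges, possibly modified; fixed points are
   vertices without external edge.  The set [U] consists of untyped vertices. *)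
Section Greedy.
Variable o : G -> G.
Hypothesis oK : involutive o.
Hypothesis o_mid : forall v, ext v = v -> o v = v.

Definition linked (u v : G) : bool := inner u v || (o u == v) && (u != v).

Definition well_typed (U : {set G}) (tau : G -> option bool) : Prop :=
  [/\ forall u v, u \notin U -> v \notin U -> inner u v -> tau u != tau v,
      forall u, u \notin U -> o u \notin U -> o u != u -> tau u != tau (o u) &
      forall u, u \notin U -> dend u -> tau u != None].

Lemma linkedC u v : linked u v = linked v u.
Proof. by rewrite /linked innerC (eq_sym u v) (can2_eq oK oK) (eq_sym u). Qed.

(** As [a] is untyped, at most two neighbours restrict [b], and three types are available. *)
Lemma extend_tri (U : {set G}) (tau : G -> option bool) (a b : G) :
  tri b -> a \in U -> linked b a -> well_typed (b |: U) tau ->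
  exists tau', well_typed U tau'.
Proof.
move=> tb aU ba [P1 P2 P3]; have [l [r [_ _ _ _ Nb]]] := tri_triangle tb.
have ilr v : inner b v -> v \in [:: l; r].
  by move=> /andP[]; rewrite Nb !inE orbA => /orP[//|->].
have : a \in [:: l; r; o b].
  case/orP: ba => [/ilr|/andP[/eqP<- _]]; last by rewrite !inE eqxx !orbT.
  by rewrite !inE => /orP[] ->; rewrite ?orbT.
rewrite !inE => a_in.
have [c cP] : exists c, forall n, n \in [:: l; r; o b] -> n \notin U -> c != tau n.
  case/or3P: a_in => /eqP aE; [exists (avoid (tau r) (tau (o b)))|
    exists (avoid (tau l) (tau (o b)))|exists (avoid (tau l) (tau r))] => n;
  rewrite !inE => /or3P[] /eqP-> nU; rewrite ?avoidl //;
  first [by rewrite -aE aU in nU | by rewrite avoidC avoidl].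
have cI v : v \notin U -> inner b v -> c != tau v.
  move=> vU /ilr; rewrite !inE => vlr; apply: cP vU.
  by rewrite !inE orbA vlr.
exists (fun v => if v == b then c else tau v); split.
- move=> u v uU vU uv.
  case: (eqVneq u b) uv => [->|ub] uv; case: (eqVneq v b) uv => [->|vb] uv.
  + by move: uv; rewrite /inner adj_irrefl.
  + exact: cI.
  + by rewrite eq_sym; apply: cI; rewrite // innerC.
  + by apply: P1; rewrite // !inE negb_or ?ub ?vb.
- move=> u uU ouU ou; case: (eqVneq u b) ou ouU => [->|ub] ou ouU.
    by rewrite (negPf ou); apply: cP; rewrite ?inE ?eqxx ?orbT.
  case: (eqVneq (o u) b) => [oub|oub].
    rewrite eq_sym; apply: cP => //; rewrite !inE -oub oK eqxx ?orbT //.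
  by apply: P2; rewrite // !inE negb_or ?ub ?oub.
- move=> u uU uD; case: (eqVneq u b) uD => [->|ub] uD.
    by move: tb; rewrite /tri uD andbF.
  by apply: P3; rewrite // !inE negb_or ub.
Qed.

(** Only the links of the two ends restrict their common type [c]; the middle vertices take type 1
    and the remaining type. A modified [o] might link the two ends with each other, which the first
    conjunct excludes. *)
Lemma extend_diamond (U : {set G}) (tau : G -> option bool) (x y z w : G)
    (c : option bool) :
  diamond x y z w -> c != None ->
  (forall v, v \in [:: x; w] -> o v \notin U -> o v != v ->
     (o v \notin [:: x; y; z; w]) && (c != tau (o v))) ->
  well_typed (U :|: [set v in [:: x; y; z; w]]) tau ->
  exists tau', well_typed U tau'.
Proof.
move=> D cA cP [P1 P2 P3].
have [yE zE _ _] := diamond_mid D; have /andP[xD wD] := diamond_ends D.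
have [xE wE] := (dend_ext xD, dend_ext wD).
have /and5P[nxw /adj_neq nxy /adj_neq nxz /adj_neq nyz
            /andP[/adj_neq nyw /adj_neq nzw]] := D.
have D' : diamond w y z x by rewrite -diamond_rev.
pose tau' v := if (v == x) || (v == w) then c else if v == y then None else
  if v == z then avoid None c else tau v.
have tx : tau' x = c by rewrite /tau' eqxx.
have tw : tau' w = c by rewrite /tau' eqxx orbT.
have ty : tau' y = None by rewrite /tau' !(eq_sym y) (negPf nxy) eq_sym (negPf nyw) eqxx.
have tz : tau' z = avoid None c.
  by rewrite /tau' !(eq_sym z) (negPf nxz) (negPf nyz) eq_sym (negPf nzw) eqxx.
have tN v : v \notin [:: x; y; z; w] -> tau' v = tau v.
  rewrite /tau' !inE; case: (v == x) => //; case: (v == y) => //.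
  by case: (v == z) => //; case: (v == w).
have UN v : v \notin U -> v \notin [:: x; y; z; w] ->
    v \notin U :|: [set v in [:: x; y; z; w]].
  by move=> vU vD; rewrite in_setU negb_or vU inE.
have oD v : o v \notin U -> o v != v -> v \in [:: x; y; z; w] ->
    [/\ tau' v = c, o v \notin [:: x; y; z; w] & c != tau (o v)].
  move=> ovU ov; rewrite inE => /orP[/eqP vE|].
    have vin : v \in [:: x; w] by rewrite vE !inE eqxx.
    by have /andP[? ?] := cP v vin ovU ov; rewrite {1}vE.
  rewrite !inE => /or3P[] /eqP vE.
  - by rewrite vE o_mid ?eqxx in ov.
  - by rewrite vE o_mid ?eqxx in ov.
  have vin : v \in [:: x; w] by rewrite vE !inE eqxx orbT.
  by have := cP v vin ovU ov; rewrite !inE => /andP[? ?]; rewrite {1}vE.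
exists tau'; split.
- move=> u v uU vU uv.
  have [uD|uD] := boolP (u \in [:: x; y; z; w]); last first.
    have vD : v \notin [:: x; y; z; w].
      by apply: contra uD => vD; apply: inner_diamond D vD _; rewrite innerC.
    by rewrite !tN //; apply: P1 => //; apply: UN.
  have vD := inner_diamond D uD uv; have /andP[auv _] := uv.
  have NK := noK4 D; have NK' := noK4 D'.
  move: uD vD auv; rewrite !inE => /or4P[] /eqP-> /or4P[] /eqP->;
    rewrite ?adj_irrefl ?(negPf NK) ?(negPf NK') // ?tx ?ty ?tz ?tw => _;
    by case: (c) cA => [[]|].
- move=> u uU ouU ou.
  have [uD|uD] := boolP (u \in [:: x; y; z; w]).
    by have [-> oN cN] := oD u ouU ou uD; rewrite tN.
  have [ouD|ouD] := boolP (o u \in [:: x; y; z; w]); last first.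
    by rewrite !tN //; apply: P2 => //; apply: UN.
  have [||-> _] := oD (o u) _ _ ouD; rewrite oK ?(eq_sym u) // => cN.
  by rewrite tN // eq_sym.
- move=> u uU uD; have [uD'|uD'] := boolP (u \in [:: x; y; z; w]); last first.
    by rewrite tN //; apply: P3 => //; apply: UN.
  move: uD' uD; rewrite !inE => /or4P[] /eqP->; rewrite ?tx ?tw //.
    by rewrite (negPf (mid_not_dend yE)).
  by rewrite (negPf (mid_not_dend zE)).
Qed.

(** Induction on the number of vertices to be typed: a vertex or diamond linked to [U] is added to
    the untyped set and typed last, when its link to [U] still imposes nothing. *)
Lemma greedy (U : {set G}) (r : G) : diamond_closed U -> r \in U ->
  (forall v, connect linked r v) -> exists tau, well_typed U tau.
Proof.
have [n] := ubnP #|~: U|; elim: n U => // n IH U; rewrite ltnS => leU dU rU conn.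
have [U0|[b0 b0U]] := set_0Vmem (~: U).
  exists (fun=> None); split=> u; have : u \notin ~: U by rewrite U0 inE.
  - by rewrite inE negbK => ->.
  - by rewrite inE negbK => ->.
  - by rewrite inE negbK => ->.
rewrite inE in b0U; have [a [b [aU bU ab]]] := connect_crossing (conn b0) rU b0U.
have ba : linked b a by rewrite linkedC.
have [tb|/not_tri_diamond[x [y [z [w [D bD]]]]]] := boolP (tri b).
  have [||tau tauP] := IH (b |: U) _ _ (setU1r b rU) conn.
  - apply: leq_trans leU; apply: proper_card; rewrite setCU setIC.
    apply/properP; split; first exact: subsetIl.
    by exists b; rewrite !inE ?eqxx ?andbF.
  - move=> x y z w u D uD; rewrite !inE => /orP[/eqP uE|uU].
      by have := tri_not_diamond tb D; rewrite -uE uD.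
    by move=> v vD; rewrite !inE (dU x y z w u) ?orbT.
  exact: extend_tri tb aU ba tauP.
have oa : o b = a.
  case/orP: ba => [/(inner_diamond D bD) aD|/andP[/eqP //]].
  by move: bU; rewrite (dU _ _ _ _ _ D aD aU b bD).
have [x' [y' [z' [w' [D' bx]]]]] : exists x' y' z' w', diamond x' y' z' w' /\ b = x'.
  have [yE zE _ _] := diamond_mid D.
  have bb : o b != b by rewrite oa; apply: contraTneq aU => ->.
  move: bD; rewrite !inE => /or4P[] /eqP bE.
  - by exists x, y, z, w.
  - by rewrite bE o_mid ?eqxx in bb.
  - by rewrite bE o_mid ?eqxx in bb.
  - by exists w, y, z, x; rewrite -diamond_rev.
have [|||tau tauP] := IH (U :|: [set v in [:: x'; y'; z'; w']]) _ _ _ conn.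
- apply: leq_trans leU; apply: proper_card; rewrite setCU.
  apply/properP; split; first exact: subsetIl.
  by exists b; rewrite !inE ?bU // bx eqxx andbF.
- move=> p q s t u E uE; rewrite in_setU => /orP[uU|].
    by move=> v vE; rewrite in_setU (dU _ _ _ _ _ E uE uU v vE).
  rewrite inE => uD' v vE; rewrite in_setU inE.
  by rewrite (diamond_meet D' E uD' uE vE) orbT.
- by rewrite in_setU rU.
(* The end [x'] is linked to an untyped vertex, so only the link of [w'] counts, and one of the
   types 2 and 3 is free. *)
pose c : option bool := if tau (o w') == Some true then Some false else Some true.
apply: (@extend_diamond _ _ _ _ _ _ c D' _ _ tauP); first by rewrite /c; case: ifP.
have [yE zE _ _] := diamond_mid D'.
move=> v; rewrite !inE => /orP[] /eqP->; first by rewrite -bx oa aU.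
move=> owU ow; apply/andP; split; last first.
  by rewrite /c; case: (tau (o w')) => [[]|].
have Dw : w' \in [:: x'; y'; z'; w'] by rewrite !inE eqxx !orbT.
have /and5P[_ _ _ _ /andP[/adj_neq yw /adj_neq zw]] := D'.
rewrite !negb_or ow andbT; apply/and3P; split; apply/eqP => E.
- have wU : w' \in U by rewrite -(oK w') E -bx oa.
  by move: bU; rewrite (dU _ _ _ _ _ D' Dw wU) // bx !inE eqxx.
- by move: yw; rewrite -(oK w') E o_mid ?eqxx.
- by move: zw; rewrite -(oK w') E o_mid ?eqxx.
Qed.

End Greedy.
(** * A cycle through an isolated triangle *)

Definition clique (x : G) : {set G} := [set u | (u == x) || inner x u].

Definition avoiding (x u v : G) : bool :=
  [&& u -- v, u \notin clique x & v \notin clique x].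

Lemma avoidingC x u v : avoiding x u v = avoiding x v u.
Proof. by rewrite /avoiding adj_sym; case: (v -- u) => //=; rewrite andbC. Qed.

Lemma connect_avoidingC x u v :
  connect (avoiding x) u v = connect (avoiding x) v u.
Proof. by apply: sym_connect_sym => a b; rewrite avoidingC. Qed.

Lemma clique_id x : x \in clique x.
Proof. by rewrite inE eqxx. Qed.

Lemma clique_tri x t : tri x -> t \in clique x -> tri t.
Proof. by move=> tx; rewrite inE => /predU1P[->//|]; apply: tri_inner. Qed.

Lemma clique_eq x t : tri x -> t \in clique x -> clique t = clique x.
Proof.
move=> tx; rewrite inE => tin.
have sub a b : tri a -> b \in clique a -> clique a \subset clique b.
  move=> ta; rewrite inE => ba; apply/subsetP => s; rewrite !inE => sa.
  have [//|nsb /=] := eqVneq s b.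
  have tb : tri b by case/predU1P: ba => [->//|]; apply: tri_inner.
  have bs : b -- s by rewrite adj_sym; apply: tri_clique ta sa ba nsb.
  case/orP: (adj_inner bs) => [/eqP sE|//].
  case/predU1P: ba sE nsb bs => [->|ab] sE nsb bs.
    by case/predU1P: sa nsb => [->|]; rewrite ?eqxx.
  case/predU1P: sa => [sa|sa]; first by rewrite sa innerC.
  apply: (triangle_inner (b := a)) => //; first by rewrite adj_sym; case/andP: ab.
  by rewrite adj_sym; case/andP: sa.
have tt : tri t by case/predU1P: tin => [->//|]; apply: tri_inner.
apply/eqP; rewrite eqEsubset; apply/andP; split; apply: sub; rewrite // inE //.
by rewrite eq_sym innerC.
Qed.

Lemma ext_clique x : tri x -> ext x \notin clique x.
Proof.
by move=> /andP[xE _]; rewrite inE (negPf xE) /inner eqxx andbF.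
Qed.

Lemma opp_dend (x : G) : dend x -> [/\ dend (opp x), opp (opp x) = x & opp x != x].
Proof.
move=> /dendP[y [z [w D]]]; have D' : diamond w y z x by rewrite -diamond_rev.
have /andP[_ wD] := diamond_ends D.
rewrite (oppE D) (oppE D'); split=> //.
by have /and5P[+ _ _ _ _] := D; rewrite eq_sym.
Qed.

Lemma even_dends (A : {set G}) :
  (forall x, x \in A -> dend x && (opp x \in A)) -> ~~ odd #|A|.
Proof.
move=> AP; pose f x := if dend x then opp x else x.
apply: (@even_involution _ _ f) => [x|x xA]; last first.
  by have /andP[xD oA] := AP x xA; rewrite /f xD oA; have [] := opp_dend xD.
by rewrite {2}/f; case: ifP => xD; rewrite /f ?xD //; have [-> ->] := opp_dend xD.
Qed.

(* Otherwise take a triangle [x] whose component [K x], reached through its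
   external edge, is smallest. It contains no isolated triangle, hence it is
   made of diamonds, whose ends are paired by [opp] and, apart from [ext x],
   by [ext]: a contradiction of parities. *)
Lemma exists_tri_cycle (v : G) : tri v ->
  exists x x', [/\ tri x, inner x x' & connect (avoiding x) (ext x) (ext x')].
Proof.
pose P x := [exists x', inner x x' && connect (avoiding x) (ext x) (ext x')].
case: (pickP (fun x => tri x && P x)) => [x /andP[tx /existsP[x' /andP[? ?]]] _|N].
  by exists x, x'.
have H x x' : tri x -> inner x x' -> ~~ connect (avoiding x) (ext x) (ext x').
  move=> tx xx'; apply/negP => C; have := N x; rewrite tx /=.
  by move=> /existsP[]; exists x'; rewrite xx'.
pose K x := [set u | connect (avoiding x) (ext x) u].
have KN x u : tri x -> u \in K x -> u \notin clique x.
  rewrite inE => tx C; apply/negP => uin.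
  have [||a [b [_ bU /and3P[_ _ bN]]]] := connect_crossing (U := ~: clique x) C.
  - by rewrite in_setC ext_clique.
  - by rewrite in_setC negbK.
  by rewrite in_setC bN in bU.
have Kstep x a b : tri x -> a \in K x -> a -- b -> b \notin clique x -> b \in K x.
  move=> tx aK ab bN; have aN := KN _ _ tx aK; move: aK; rewrite !inE => C.
  by apply: connect_trans C (connect1 _); rewrite /avoiding ab aN.
have KE x : ext x \in K x by rewrite inE connect0.
move=> tv; exfalso; have [n] := ubnP #|K v|; elim: n v tv => // n IH x tx.
rewrite ltnS => leK.
have [/exists_inP[s sK ts]|] := boolP [exists s in K x, tri s].
  have sNx := KN _ _ tx sK.
  have disj t : t \in clique s -> t \notin clique x.
    move=> tin; apply: contra sNx => tx'.
    by rewrite -(clique_eq tx tx') (clique_eq ts tin) clique_id.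
  have [a [_ [sa _ _ _ _]]] := tri_triangle ts.
  have ain : a \in clique s by rewrite inE sa orbT.
  have ta := tri_inner ts sa.
  have cas := clique_eq ts ain.
  have ava : avoiding a =2 avoiding s by move=> p q; rewrite /avoiding cas.
  (* If [x] lay in both [K s] and [K a], then [ext s] and [ext a] would be connected outside their
     triangle. With [x] outside [K s'], the set [K s'] misses the whole triangle of [x] and is
     strictly smaller than [K x]. *)
  have [s' s'in xs'] : exists2 s', s' \in clique s & x \notin K s'.
    have [xs|] := boolP (x \in K s); last by exists s; rewrite ?clique_id.
    exists a => //; apply: contraNN (H s a ts sa) => xa.
    move: xs xa; rewrite !inE (eq_connect ava) (connect_avoidingC _ (ext a)).
    exact: connect_trans.
  have ts' := clique_tri ts s'in; have cs' := clique_eq ts s'in.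
  have s'K : s' \in K x.
    have [->//|ns] := eqVneq s' s; apply: (Kstep x s) => //; last exact: disj.
    by move: s'in; rewrite inE (negPf ns) => /andP[].
  have KNx t : t \in K s' -> t \notin clique x.
    move=> tK; apply: contra xs' => tin.
    have [<-//|nt] := eqVneq t x.
    apply: (Kstep s' t) => //.
      by rewrite adj_sym; move: tin; rewrite inE (negPf nt) => /andP[].
    by rewrite cs'; apply/negP => /disj; rewrite clique_id.
  have /andP[s'E _] := ts'.
  have KK : K s' \proper K x.
    apply/properP; split; last first.
      by exists s' => //; apply: contraTN (clique_id s') => /(KN _ _ ts').
    apply/subsetP => t tK; apply: contraT => tNK.
    have [|||u [u' []]] := connect_crossing (U := K x :|: ~: K s')
      (a := ext s') (b := t) (e := avoiding s').
    - by move: tK; rewrite inE.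
    - rewrite in_setU; apply/orP; left; apply: (Kstep x s') => //.
        exact: adj_ext.
      by apply: KNx; apply: KE.
    - by rewrite in_setU negb_or tNK in_setC negbK.
    rewrite !in_setU !in_setC negb_or negbK => uU /andP[u'x u's] uu'.
    have us : u \in K s'.
      by apply: (Kstep s' u') => //; case/and3P: uu' => [? ? _]; rewrite 1?adj_sym.
    move: uU; rewrite us orbF => ux; move: u'x; rewrite (Kstep x u) //.
      by case/and3P: uu'.
    exact: KNx.
  by apply: (IH s' ts'); apply: leq_trans (proper_card KK) leK.
rewrite negb_exists => /forallP noT.
have Kdend u : u \in K x -> ext u != u -> dend u.
  by move=> uK uE; have := noT u; rewrite uK /tri uE /= negbK.
have /andP[xE _] := tx.
pose E := [set u in K x | dend u].
have evE : ~~ odd #|E|.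
  apply: even_dends => u; rewrite inE => /andP[uK uD]; rewrite uD /= inE.
  have [-> _ _] := opp_dend uD; rewrite andbT.
  move: (uD) => /dendP[y [z [w D]]]; rewrite (oppE D).
  have DN t : t \in [:: u; y; z; w] -> t \notin clique x.
    move=> tD; apply/negP => /(clique_tri tx) tt.
    by have := tri_not_diamond tt D; rewrite tD.
  have /and5P[_ uy _ _ /andP[yw _]] := D.
  apply: (Kstep x y) => //; last by apply: DN; rewrite !inE eqxx !orbT.
  by apply: (Kstep x u) => //; apply: DN; rewrite !inE eqxx !orbT.
have xyE : ext x \in E by rewrite inE KE Kdend // ext_eq.
(* The external edges of the other two vertices of the triangle do not end in [K x], so [ext x] is
   the only end whose external edge leaves [K x]. *)
have : ~~ odd #|E :\ ext x|.
  apply: (even_involution extK) => u; rewrite !inE => /and3P[ux uK uD].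
  have uE := dend_ext uD; rewrite uE andbT (inj_eq ext_inj).
  have uN : ext u \notin clique x.
    rewrite inE; apply/norP; split.
      by apply: contra ux => /eqP<-; rewrite extK.
    by apply: contraTN uK => /(H x _ tx); rewrite extK.
  have euK : ext u \in K x.
    by apply: (Kstep x u) => //; [rewrite inE|apply: adj_ext].
  rewrite Kdend ?ext_eq //; move: (euK); rewrite inE => ->.
  rewrite !andbT; apply: contraTneq uK => ->.
  by apply/negP => C; have := KN x x tx; rewrite inE clique_id => /(_ C).
by move: evE; rewrite (cardsD1 (ext x)) xyE /= => /negP.
Qed.
Hypothesis Gconn : forall x y : G, connect (@adj G) x y.

Lemma connect_closed (S : {set G}) (r : G) : r \in S ->
  (forall u v : G, u \in S -> u -- v -> v \in S) -> forall v, v \in S.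
Proof.
move=> rS cS v; apply: contraT => vS.
have [a [b [aS bS ab]]] := connect_crossing (Gconn r v) rS vS.
by rewrite (cS a b) in bS.
Qed.

(* The triangle is removed and the external edges at [x1] and [x3] are merged,
   so that their far ends get different types; the external edge at [x2] then
   leaves the slack that the greedy procedure needs, and the triangle can be
   typed last. *)
Lemma tri_types (v : G) : tri v -> exists tau : G -> option bool,
  (forall u w : G, u -- w -> tau u != tau w) /\
  (forall x : G, dend x -> tau x != None).
Proof.
move=> /exists_tri_cycle[x2 [x1 [t2 i21 C]]].
have [x3 [i23 a13]] : exists x3, inner x2 x3 /\ x1 -- x3.
  have [a [b [ia ib ab _ N2]]] := tri_triangle t2.
  have /andP[] := i21; rewrite N2 !inE => /or3P[] /eqP-> E.
  - by exists b.
  - by exists a; rewrite adj_sym.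
  - by rewrite eqxx in E.
have [t1 t3] := (tri_inner t2 i21, tri_inner t2 i23).
have [/andP[E1 D1] /andP[E2 D2] /andP[E3 D3]] := And3 t1 t2 t3.
have [/andP[a21 n21] /andP[a23 n23]] := (i21, i23).
have clE u : (u \in clique x2) = (u \in [:: x1; x2; x3]).
  have [_ N2] := triangle_nbE E2 a21 a23 a13.
  rewrite !inE /inner N2 !inE; have [->|_ /=] := eqVneq u x2; first by rewrite orbT.
  have [->|_ /=] := eqVneq u x1; first by rewrite n21.
  have [->|_ /=] := eqVneq u x3; first by rewrite n23.
  by case: (u == ext x2).
have a12 : x1 -- x2 by rewrite adj_sym.
have a31 : x3 -- x1 by rewrite adj_sym.
have a32 : x3 -- x2 by rewrite adj_sym.
have i12 : inner x1 x2 by rewrite innerC.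
have i32 : inner x3 x2 by rewrite innerC.
have i13 : inner x1 x3 := triangle_inner a13 a12 a32.
have extN x : x \in clique x2 -> ext x \notin clique x2.
  move=> xin; rewrite -(clique_eq t2 xin); apply: ext_clique.
  exact: clique_tri t2 xin.
have c1 : x1 \in clique x2 by rewrite clE !inE eqxx.
have c2 : x2 \in clique x2 by rewrite clE !inE eqxx orbT.
have c3 : x3 \in clique x2 by rewrite clE !inE eqxx !orbT.
have y1N := extN _ c1; have y2N := extN _ c2; have y3N := extN _ c3.
have nin a b : a \in clique x2 -> b \notin clique x2 -> (a == b) = false.
  by move=> ain bN; apply/negbTE; apply: contraTneq ain => ->.
have out u : u \notin clique x2 ->
    ((u == x1) = false) * ((u == x2) = false) * ((u == x3) = false).
  by move=> uN; rewrite !(eq_sym u) !nin.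
have n12 : (x1 == x2) = false by apply/negbTE/adj_neq.
have n13 : (x1 == x3) = false by apply/negbTE/adj_neq.
have n23' : (x2 == x3) = false by apply/negbTE/adj_neq.
set y1 := ext x1 in y1N *; set y2 := ext x2 in C y2N *; set y3 := ext x3 in y3N *.
have y13 : (y1 == y3) = false by rewrite /y1 /y3 (inj_eq ext_inj) n13.
have y23 : (y2 == y3) = false by rewrite /y2 /y3 (inj_eq ext_inj) n23'.
pose o u := if (u == x1) || (u == x3) then u else
  if u == y1 then y3 else if u == y3 then y1 else ext u.
have o1 : o y1 = y3 by rewrite /o !out // eqxx.
have o3 : o y3 = y1 by rewrite /o !out //= (eq_sym y3) y13 eqxx.
have oE u : u \notin [:: x1; x3; y1; y3] -> o u = ext u.
  by rewrite !inE !negb_or /o => /and4P[/negPf-> /negPf-> /negPf-> /negPf->].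
have o0 u : u \in [:: x1; x3] -> o u = u by rewrite !inE /o => ->.
have oN u : u \notin [:: x1; x3; y1; y3] -> ext u \notin [:: x1; x3; y1; y3].
  by rewrite !inE !(can2_eq extK extK) -/y1 -/y3 !extK !negb_or => /and4P[-> -> -> ->].
have oK : involutive o.
  move=> u; have [|uN] := boolP (u \in [:: x1; x3; y1; y3]); last first.
    by rewrite (oE u) // oE ?oN // extK.
  rewrite inE [u \in [:: x3; _; _]]inE orbA => /orP[u13|].
    by rewrite !o0 ?inE.
  by rewrite !inE => /orP[] /eqP->; rewrite ?o1 ?o3 ?o1.
have o_mid u : ext u = u -> o u = u.
  move=> uE; rewrite oE // !inE !negb_or.
  by apply/and4P; split; apply: contra_eq_neq uE => ->;
     rewrite // /y1 /y3 ext_eq.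
have step u w : u -- w -> u \notin [:: x1; x3; y1; y3] -> linked o u w.
  move=> uw uN; rewrite /linked oE //; case/orP: (adj_inner uw) => [/eqP wE|->//].
  by rewrite -wE eqxx (adj_neq uw) orbT.
(* Cutting [x1] and [x3] off from [y1] and [y3] does not disconnect: [y2] is still linked to [x2],
   the path [C] avoiding the triangle leads from [y2] to [y1], and the merged edge leads on to
   [y3]. *)
have conn : forall u, connect (linked o) x2 u.
  suff H u : u \in [set u | connect (linked o) x2 u] by move=> u; have := H u; rewrite inE.
  have s1 : connect (linked o) x2 x1 by apply: connect1; rewrite /linked i21.
  have s3 : connect (linked o) x2 x3 by apply: connect1; rewrite /linked i23.
  have s2' : connect (linked o) x2 y2.
    apply: connect1; apply: step; first exact: adj_ext.
    by rewrite !inE eq_sym n12 n23' (nin _ _ c2 y1N) (nin _ _ c2 y3N).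
  have s1' : connect (linked o) x2 y1.
    apply: connect_trans s2' _; apply: connect_sub C => a b /and3P[ab aN bN].
    apply: connect1; case/orP: (adj_inner ab) => [/eqP bE|]; last by rewrite /linked => ->.
    apply: step => //; rewrite !inE !out //=; apply/norP; split.
      by apply: contraNneq bN => aE; rewrite bE aE /y1 extK.
    by apply: contraNneq bN => aE; rewrite bE aE /y3 extK.
  have s3' : connect (linked o) x2 y3.
    by apply: connect_trans s1' (connect1 _); rewrite /linked o1 eqxx y13 orbT.
  apply: (connect_closed (r := x2)); first by rewrite inE connect0.
  move=> a b; rewrite !inE => Ca ab.
  case/orP: (adj_inner ab) => [/eqP bE|iab]; last first.
    by apply: connect_trans Ca (connect1 _); rewrite /linked iab.
  have [|aN] := boolP (a \in [:: x1; x3; y1; y3]); last first.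
    by apply: connect_trans Ca (connect1 _); apply: step.
  by rewrite bE !inE => /or4P[] /eqP->; rewrite ?extK.
have clos : diamond_closed (clique x2).
  move=> x y z w u D uD uc.
  by have := tri_not_diamond (clique_tri t2 uc) D; rewrite uD.
have [tau [P1 P2 P3]] := greedy oK o_mid clos c2 conn.
(* The merged edge makes the lists of allowed types at [x1] and [x3] different. *)
have nt13 : tau y1 != tau y3.
  by rewrite -o1; apply: P2; rewrite // o1 // eq_sym y13.
have [p [q [s [U pP qP sP]]]] := avoiding_types (tau y2) nt13.
pose tau' u := if u == x1 then p else if u == x2 then q else
  if u == x3 then s else tau u.
have T1 : tau' x1 = p by rewrite /tau' eqxx.
have T2 : tau' x2 = q by rewrite /tau' eq_sym n12 eqxx.
have T3 : tau' x3 = s by rewrite /tau' !(eq_sym x3) n13 n23' eqxx.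
have TN u : u \notin clique x2 -> tau' u = tau u.
  by move=> uN; rewrite /tau' !out.
move: U; rewrite /= !inE negb_or => /and3P[/andP[npq nps] nqs _].
exists tau'; split; last first.
  move=> x xD; have [|xN] := boolP (x \in clique x2); last by rewrite TN //; apply: P3.
  rewrite clE !inE => /or3P[] /eqP xE.
  - by rewrite -xE xD in D1.
  - by rewrite -xE xD in D2.
  - by rewrite -xE xD in D3.
have Tin u w : u \in clique x2 -> u -- w -> tau' u != tau' w.
  move=> uin uw; have [win|wN] := boolP (w \in clique x2).
    move: uin win uw; rewrite !clE !inE => /or3P[] /eqP-> /or3P[] /eqP->;
    by rewrite ?adj_irrefl // ?T1 ?T2 ?T3 // eq_sym.
  have wE : w = ext u.
    apply/eqP; case/orP: (adj_inner uw) => // iuw; move: wN.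
    by rewrite -(clique_eq t2 uin) inE iuw orbT.
  move: uin; rewrite (TN w) // wE clE !inE => /or3P[] /eqP->;
  by rewrite ?T1 ?T2 ?T3.
move=> u w uw; have [uin|uN] := boolP (u \in clique x2); first exact: Tin.
have [win|wN] := boolP (w \in clique x2).
  by rewrite eq_sym; apply: Tin; rewrite // adj_sym.
rewrite !TN //; case/orP: (adj_inner uw) => [/eqP wE|]; last exact: P1.
have ou : o u = w.
  rewrite wE oE // !inE !out //=; apply/norP; split.
    by apply: contraNneq wN => aE; rewrite wE aE /y1 extK.
  by apply: contraNneq wN => aE; rewrite wE aE /y3 extK.
by rewrite -ou; apply: P2; rewrite ?ou // eq_sym adj_neq.
Qed.
(** * Graphs made of diamonds *)

(** Double counting of the edges between ends and middle vertices: every end has two middle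
    neighbours and every middle vertex two ends. *)
Lemma card_all_diamonds : (forall v, ~~ tri v) ->
  #|G| = 2 * #|[set v : G | dend v]|.
Proof.
move=> noT; set E := [set v | dend v].
have cE x : x \in E -> \sum_(y in ~: E | x -- y) 1 = 2.
  rewrite inE => xD; move: (xD) => /dendP[y [z [w D]]].
  have [xE _ _ Nx] := diamond_end D; have [yE zE _ _] := diamond_mid D.
  have [yD zD] := (mid_not_dend yE, mid_not_dend zE).
  have exD : dend (ext x) by have := noT (ext x); rewrite /tri ext_eq xE /= negbK.
  have /and5P[_ _ _ /adj_neq yz _] := D.
  rewrite sum1dep_card (_ : [set _ | _] = [set y; z]) ?cards2 ?yz //.
  apply/setP => u; rewrite !inE Nx !inE.
  have [->|_] := eqVneq u y; first by rewrite yD.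
  have [->|_] := eqVneq u z; first by rewrite zD.
  by have [->|_] := eqVneq u (ext x); rewrite ?exD ?andbF.
have cN y : y \in ~: E -> \sum_(x in E | x -- y) 1 = 2.
  rewrite !inE => yD; have yE : ext y = y.
    by apply/eqP; have := noT y; rewrite /tri yD andbT negbK.
  have [x [z [w D]]] := mid_diamond yE.
  have [_ zE Ny _] := diamond_mid D; have /andP[xD wD] := diamond_ends D.
  have zD := mid_not_dend zE; have /and5P[xw _ _ _ _] := D.
  rewrite sum1dep_card (_ : [set _ | _] = [set x; w]) ?cards2 ?xw //.
  apply/setP => u; rewrite !inE adj_sym Ny !inE.
  have [->|_] := eqVneq u x; first by rewrite xD.
  have [->|_] := eqVneq u w; first by rewrite wD !orbT.
  by have [->|_] := eqVneq u z; rewrite ?(negPf zD) ?andbF.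
have : \sum_(x in E) \sum_(y in ~: E | x -- y) 1 =
       \sum_(y in ~: E) \sum_(x in E | x -- y) 1.
  rewrite (exchange_big_dep (mem (~: E))) /= => [|x y _ /andP[] //].
  by apply: eq_bigr => y yN; apply: eq_bigl => x; rewrite yN.
rewrite (eq_bigr (fun=> 2) cE) (eq_bigr (fun=> 2) cN) !sum_nat_const => /eqP.
rewrite eqn_pmul2r // => /eqP EE.
by rewrite -(cardsC E) -EE addnn mul2n.
Qed.

(* [R] accounts for an external edge whose ends get the same value of [b]. *)
Lemma two_types_card (b : G -> bool) (R : {set G}) : (forall v, ~~ tri v) ->
  (forall x y z w, diamond x y z w -> b w = b x) ->
  R \subset [set v | dend v && b v] ->
  ext @: [set v | dend v && ~~ b v] = [set v | dend v && b v] :\: R ->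
  exists2 m, ~~ odd m & #|G| = 4 * m + 2 * #|R|.
Proof.
move=> noT bP sR extR; exists #|[set v : G | dend v && ~~ b v]|.
  apply: even_dends => x; rewrite !inE => /andP[xD xb].
  have [oD _ _] := opp_dend xD; rewrite xD oD /=.
  by move: xD xb => /dendP[y [z [w D]]]; rewrite (oppE D) (bP _ _ _ _ D).
rewrite card_all_diamonds //.
have := cardsID [set v | b v] [set v : G | dend v].
rewrite (_ : _ :&: _ = [set v | dend v && b v]); last by apply/setP => v; rewrite !inE.
rewrite (_ : _ :\: _ = [set v | dend v && ~~ b v]); last first.
  by apply/setP => v; rewrite !inE andbC.
have := cardsID R [set v : G | dend v && b v].
rewrite -extR (card_imset _ ext_inj) (setIidPr sR) => <- <-.
by rewrite -addnA addnn mulnDr -mul2n mulnA addnC.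
Qed.

Lemma dend_of_ext x : (forall v, ~~ tri v) -> dend x -> dend (ext x).
Proof.
move=> noT xD; have := noT (ext x).
by rewrite /tri ext_eq (dend_ext xD) /= negbK.
Qed.

Lemma diamond_types (v0 : G) : (forall v, ~~ tri v) ->
  ~ (exists t, odd t /\ #|G| = 4 * t) ->
  exists tau : G -> option bool,
  (forall u w : G, u -- w -> tau u != tau w) /\
  (forall x : G, dend x -> tau x != None).
Proof.
move=> noT Nodd; have [x0 [y0 [z0 [w0 [D0 _]]]]] := not_tri_diamond (noT v0).
pose U := [set v in [:: x0; y0; z0; w0]].
have clos : diamond_closed U.
  move=> x y z w u D uD; rewrite inE => uU v vD; rewrite inE.
  exact: diamond_meet D0 D uU uD v vD.
have conn v : connect (linked ext) x0 v.
  have : v \in [set v | connect (linked ext) x0 v]; last by rewrite inE.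
  apply: (connect_closed (r := x0)); first by rewrite inE connect0.
  move=> a b; rewrite !inE => Ca ab; apply: connect_trans Ca (connect1 _).
  rewrite /linked; case/orP: (adj_inner ab) => [/eqP bE|->//].
  by rewrite -bE eqxx (adj_neq ab) orbT.
have x0U : x0 \in U by rewrite !inE eqxx.
have [tau [P1 P2 P3]] := greedy extK (fun _ vE => vE) clos x0U conn.
have UE : U =i [:: x0; y0; z0; w0] by move=> v; rewrite inE.
have extN (x y z w : G) : diamond x y z w -> U =i [:: x; y; z; w] -> ext x \notin U.
  by move=> /diamond_end[_ + _ _] UD; rewrite UD.
have D0' : diamond w0 y0 z0 x0 by rewrite -diamond_rev.
have UE' : U =i [:: w0; y0; z0; x0].
  move=> v; rewrite UE !inE.
  by case: (v == x0); case: (v == y0); case: (v == z0); case: (v == w0).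
have [xN wN] := (extN _ _ _ _ D0 UE, extN _ _ _ _ D0' UE').
have /andP[xD wD] := diamond_ends D0.
have xA := P3 _ xN (dend_of_ext noT xD); have wA := P3 _ wN (dend_of_ext noT wD).
(* The diamond left untyped can be typed if its two external neighbours agree: the other one of the
   types 2 and 3 then suits both ends. *)
have [xw|xw] := eqVneq (tau (ext x0)) (tau (ext w0)).
  pose c := avoid None (tau (ext x0)).
  have [cA cx] : c != None /\ c != tau (ext x0).
    by rewrite /c avoidl avoidC avoidl.
  have H v : v \in [:: x0; w0] -> ext v \notin set0 -> ext v != v ->
      (ext v \notin [:: x0; y0; z0; w0]) && (c != tau (ext v)).
    move=> vin _ _; rewrite -UE; move: vin.
    rewrite [v \in _]inE mem_seq1 => /orP[] /eqP->; first by rewrite xN.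
    by rewrite wN -xw.
  have UU : well_typed ext (set0 :|: U) tau by rewrite set0U; split.
  have [tau' [Q1 Q2 Q3]] := extend_diamond extK (fun _ vE => vE) D0 cA H UU.
  exists tau'; split=> [u v uv|x]; last by apply: Q3; rewrite inE.
  case/orP: (adj_inner uv) => [/eqP vE|]; last by apply: Q1; rewrite inE.
  by rewrite vE; apply: Q2; rewrite ?inE // -vE eq_sym adj_neq.
exfalso; apply: Nodd.
have odd_case (x y z w : G) : diamond x y z w -> U =i [:: x; y; z; w] ->
    ext x \notin U -> ext w \notin U ->
    tau (ext x) = Some true -> tau (ext w) = Some false ->
    exists t, odd t /\ #|G| = 4 * t.
  move=> D UD exN ewN exB ewC; have /and5P[nxw _ _ _ _] := D.
  have /andP[xD' wD'] := diamond_ends D; have [yE zE _ _] := diamond_mid D.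
  have xU : x \in U by rewrite UD !inE eqxx.
  have wU : w \in U by rewrite UD !inE eqxx !orbT.
  have dU v : dend v -> v \in U -> (v == x) || (v == w).
    move=> vD; rewrite UD !inE => /or4P[] vE; rewrite ?vE ?orbT //;
    by move: vD; rewrite (eqP vE) (negPf (mid_not_dend _)).
  (* The untyped diamond is counted as type 2. Then the external edge at [x] is the only one whose
     ends agree, so the exceptional set is made of its two ends and the order is [4 * m + 4] with
     [m] even. *)
  pose b v := (v \in U) || (tau v == Some true).
  have [|||m m_even mE] := @two_types_card b [set x; ext x] noT.
  - move=> p q s t E; rewrite /b.
    have pt : (p \in U) = (t \in U).
      by apply/idP/idP => pU; apply: (clos _ _ _ _ _ E _ pU);
         rewrite !inE eqxx ?orbT.
    rewrite pt; case tU: (t \in U) => //=; congr (_ == _).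
    have EN v : v \in [:: p; q; s; t] -> v \notin U.
      move=> vE; apply: contraFN tU => vU.
      by apply: (clos _ _ _ _ _ E vE vU); rewrite !inE eqxx !orbT.
    have [pN qN sN tN] : [/\ p \notin U, q \notin U, s \notin U & t \notin U].
      by split; apply: EN; rewrite !inE eqxx ?orbT.
    have /and5P[_ pq ps qs /andP[qt st]] := E.
    have [sp sq] : s -- p /\ s -- q by split; rewrite adj_sym.
    have [tq ts] : t -- q /\ t -- s by split; rewrite adj_sym.
    have := P1 p q pN qN (triangle_inner pq ps qs).
    have := P1 p s pN sN (triangle_inner ps pq sq).
    have := P1 t q tN qN (triangle_inner tq ts qs).
    have := P1 t s tN sN (triangle_inner ts tq sq).
    have qp : q -- p by rewrite adj_sym.
    have := P1 q s qN sN (triangle_inner qs qp sp).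
    by case: (tau p) (tau q) (tau s) (tau t) => [[]|] [[]|] [[]|] [[]|].
  - apply/subsetP => v; rewrite !inE => /orP[] /eqP->.
      by rewrite xD' /b xU.
    by rewrite dend_of_ext // /b exB orbT.
  - apply/setP => v; rewrite -{1}(extK v) (mem_imset _ _ ext_inj) !inE.
    have -> : dend (ext v) = dend v.
      apply/idP/idP; last exact: dend_of_ext.
      by move=> /(dend_of_ext noT); rewrite extK.
    have [vD|] := boolP (dend v); last by rewrite andbF.
    have evD := dend_of_ext noT vD; rewrite /= /b.
    have [vU|vN] := boolP (v \in U).
      case/orP: (dU v vD vU) => /eqP->; first by rewrite eqxx exB orbT.
      rewrite ewC (negPf ewN) (eq_sym w x) (negPf nxw) andbT /=.
      by apply/esym/negP => /eqP wE; rewrite -wE wU in exN.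
    have [evU|evN] := boolP (ext v \in U).
      have vE := extK v; case/orP: (dU _ evD evU) => /eqP E; rewrite E in vE.
        by rewrite -vE eqxx orbT.
      by rewrite -vE ewC andbF.
    have := P2 v vN evN (dend_ext vD).
    have -> : (v == x) = false by apply: contraNF vN => /eqP->.
    have -> : (v == ext x) = false.
      by apply: contraNF evN => /eqP->; rewrite extK.
    have := P3 _ vN vD; have := P3 _ evN evD.
    by case: (tau v) (tau (ext v)) => [[]|] [[]|].
  exists m.+1; split; first by rewrite /= m_even.
  by rewrite mE cards2 eq_sym (dend_ext xD') [4 * m.+1]mulnS addnC.
case xB: (tau (ext x0)) xA wA xw => [[]|] // _.
  by case wB: (tau (ext w0)) => [[]|] // _ _; apply: odd_case D0 UE _ _ xB wB.
by case wB: (tau (ext w0)) => [[]|] // _ _; apply: odd_case D0' UE' _ _ wB xB.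
Qed.

Lemma diamond_ncol_even (K : eqType) (f : G -> G -> K) :
  (forall v, ~~ tri v) -> (forall u v : G, f u v = f v u) ->
  (forall u v : G, u -- v -> ncol f u != ncol f v) ->
  exists2 m, ~~ odd m & #|G| = 4 * m.
Proof.
move=> noT fC fP.
have dP x : dend x -> (ncol f x == 2) || (ncol f x == 3).
  move=> /dendP[y [z [w D]]]; have [_] := diamond_ncol Greg fC fP D.
  by have := ncol_bounds f x Greg; case: (ncol f x) => [|[|[|[|]]]].
have [|||m m_even ->] := @two_types_card (fun v => ncol f v == 2) set0 noT.
- by move=> x y z w D; have [->] := diamond_ncol Greg fC fP D.
- exact: sub0set.
- apply/setP => v; rewrite -{1}(extK v) (mem_imset _ _ ext_inj) !inE /=.
  have -> : dend (ext v) = dend v.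
    apply/idP/idP; last exact: dend_of_ext.
    by move=> /(dend_of_ext noT); rewrite extK.
  have [vD|//] := boolP (dend v).
  have := fP _ _ (adj_ext (dend_ext vD)).
  by case/orP: (dP v vD) => /eqP->; case/orP: (dP _ (dend_of_ext noT vD)) => /eqP->.
by exists m; rewrite // cards0 muln0 addn0.
Qed.

End Structure.

(** * The exceptional graph [K4] and the conclusion *)

Lemma K4_odd_cycle (G : sgraph) (x y z w : G) : regular_graph G 3 ->
  (forall u v : G, connect (@adj G) u v) ->
  diamond x y z w -> x -- w -> odd_cycle_of_diamonds G.
Proof.
move=> Greg Gconn D xw; have /and5P[nxw xy xz yz /andP[yw zw]] := D.
have sym (a b : G) : a -- b -> b -- a by rewrite adj_sym.
have [ne1 ne2 ne3] := And3 (adj_neq xy) (adj_neq xz) (adj_neq yz).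
have [ne4 ne5] := (adj_neq yw, adj_neq zw).
have U4 : uniq [:: x; y; z; w].
  by rewrite /= !inE !negb_or nxw ne1 ne2 ne3 ne4 ne5.
have all4 v : v \in [:: x; y; z; w].
  have : v \in [set u in [:: x; y; z; w]]; last by rewrite inE.
  apply: (connect_closed Gconn (r := x)); first by rewrite !inE eqxx.
  have sub (a b c d e : G) : a -- b -> a -- c -> a -- d -> uniq [:: b; c; d] ->
      a -- e -> e \in [:: b; c; d].
    by move=> ab ac ad U; rewrite (nb3 Greg ab ac ad U).
  move=> a b; rewrite !inE => /or4P[] /eqP-> ab.
  - have := sub x y z w b xy xz xw _ ab.
    rewrite /= !inE !negb_or ne3 ne4 ne5 => /(_ isT) /or3P[] ->; by rewrite ?orbT.
  - have := sub y x z w b (sym _ _ xy) yz yw _ ab.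
    rewrite /= !inE !negb_or ne2 nxw ne5 => /(_ isT) /or3P[] ->; by rewrite ?orbT.
  - have := sub z x y w b (sym _ _ xz) (sym _ _ yz) zw _ ab.
    rewrite /= !inE !negb_or ne1 nxw ne4 => /(_ isT) /or3P[] ->; by rewrite ?orbT.
  - have := sub w x y z b (sym _ _ xw) (sym _ _ yw) (sym _ _ zw) _ ab.
    rewrite /= !inE !negb_or ne1 ne2 ne3 => /(_ isT) /or3P[] ->; by rewrite ?orbT.
split; first by split=> // v; exists x, y, z, w.
exists 1; split=> //; rewrite muln1.
have /card_uniqP := U4; rewrite /= => <-.
by apply: eq_card => v; rewrite all4.
Qed.

Theorem theorem3 (G : sgraph)
  (Gconn : connected_graph G)
  (Greg : regular_graph G 3)
  (Gtri : forall v : G, in_triangle v) :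
  ((exists (k : nat) (c : edge_coloring G k), color_blind_distinguishing c)
     <-> ~ odd_cycle_of_diamonds G)
  /\ (~ odd_cycle_of_diamonds G -> exists2 d : nat, dal G = Some d & d <= 3).
Proof.
have [/card_gt0P[v0 _] conn] := Gconn.
have colorable3 : ~ odd_cycle_of_diamonds G -> color_blind_colorable G 3.
  move=> Nodd.
  have noK4 (x y z w : G) : diamond x y z w -> ~~ (x -- w).
    by move=> D; apply/negP => xw; apply: Nodd; apply: K4_odd_cycle D xw.
  suff [tau [tauP tauD]] : exists tau : G -> option bool,
      (forall u w : G, u -- w -> tau u != tau w) /\
      (forall x : G, dend x -> tau x != None).
    exact: types_colorable tauP tauD.
  case: (pickP (@tri G)) => [v tv|noT]; first exact: tri_types conn _ tv.
  have noT' (v : G) : ~~ tri v by rewrite noT.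
  apply: diamond_types v0 noT' _ => // oddG; apply: Nodd; split=> //.
  by split=> // v; apply: not_tri_diamond => //; rewrite noT.
split; last first.
  move=> /colorable3 c3; rewrite /dal; case: pselect => [h|[]]; last by exists 3.
  by exists (ex_minn h) => //; case: ex_minnP => m _; apply.
split=> [[k [c cP]] [[_ allD] [t [t_odd tE]]]|/colorable3/existsP[c cP]]; last first.
  by exists 3, c.
pose f := ecol c.
have fC u v : f u v = f v u by exact: ecolC.
have fP u v : u -- v -> ncol f u != ncol f v.
  by move=> uv; have /forallP/(_ u)/forallP/(_ v)/implyP/(_ uv) := cP; rewrite eq_cstar.
(* A distinguishing colouring itself rules out [K4]: the ends of a diamond see equally many colours
   and so cannot be adjacent. *)
have noK4 (x y z w : G) : diamond x y z w -> ~~ (x -- w).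
  move=> D; apply/negP => /fP; have [->] := diamond_ncol Greg fC fP D.
  by rewrite eqxx.
have noT (v : G) : ~~ tri v.
  apply/negP => tv; have [x [y [z [w [D vD]]]]] := allD v.
  by have := tri_not_diamond Greg tv D; rewrite vD.
have [m m_even mE] := diamond_ncol_even Greg Gtri noK4 noT fC fP.
by move: t_odd; have /eqP := tE; rewrite mE eqn_pmul2l // => /eqP<-; apply/negP.
Qed.
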